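(* Let $\pi=(\pi^{ij})$ be a (smooth) Poisson structure on $\mathbb{R}^d$, $\overline V=-\pi^{ij}(x)p_i\partial_{x^j}$, and $\phi^i_\epsilon(x,p)=\sum_{n\ge0}\frac{\epsilon^n}{(n+1)!}(L_{\overline V})^n(x^i)$. Let $\alpha_\epsilon(x,p)=x+\sum_{r\ge1}\epsilon^r\alpha_{(r)}(x,p)$ be the (unique) formal solution, with coefficients in $C^\infty(T^*\mathbb{R}^d)$, of $$\phi_\epsilon(\alpha_\epsilon(x,p),p)=x\qquad\forall p.$$ Then: (1) $\alpha_\epsilon$ is a formal symplectic realization $(T^*\mathbb{R}^d,\omega_0)\to(\mathbb{R}^d,\epsilon\pi)$. (2) Its coefficients are recursively determined by: for all $N\ge1$ and $i=1,\dots,d$, $$\alpha^i_{(N)}+\sum_{n=1}^{N-1}\sum_{m=1}^{N-n}\sum_{\substack{r_1,\dots,r_m\ge1\\ r_1+\cdots+r_m=N-n}}\frac{1}{(n+1)!\,m!}\,\alpha^{i_1}_{(r_1)}\cdots\alpha^{i_m}_{(r_m)}\,\frac{\partial^{m}(L^n_{\overline V}x^i)}{\partial x^{i_1}\cdots\partial x^{i_m}}+\frac{1}{(N+1)!}L^N_{\overline V}x^i=0,$$ all functions being evaluated at $(x,p)$. (3) The formal Darboux frame $\psi^{-1}_{\overline V,\epsilon}(x,p)=(\alpha_\epsilon(x,p),p)$ takes the formal Weinstein realization $q:(T^*\mathbb{R}^d,\omega_{\overline V,\epsilon})\to(\mathbb{R}^d,\epsilon\pi)$ to the formal Karasev realization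 given by $\alpha_\epsilon$; that is, $(\psi^{-1}_{\overline V,\epsilon})^*\omega_{\overline V,\epsilon}=\omega_0$ and $q\circ\psi^{-1}_{\overline V,\epsilon}=\alpha_\epsilon$ as formal power series in $\epsilon$.
   Context: Coordinates on $T^*\mathbb{R}^d$ are $(x,p)$; repeated indices are summed; $q(x,p)=x$ is the bundle projection. $\omega_0=dp_i\wedge dx^i$, with Poisson bracket $\{f,g\}_{\omega_0}=\partial_{x^i}f\,\partial_{p_i}g-\partial_{p_i}f\,\partial_{x^i}g$ (so $\{x^i,p_j\}=\delta^i_j$). $L_{\overline V}f=-\pi^{ij}(x)p_i\,\partial_{x^j}f$ on functions. Formal composition: for $w_\epsilon^i=w_0^i+\epsilon\tilde w_\epsilon^i$ with $w_0^i\in C^\infty(T^*\mathbb{R}^d)$, $\tilde w^i_\epsilon\in C^\infty(T^*\mathbb{R}^d)[[\epsilon]]$, and $f\in C^\infty(T^*\mathbb{R}^d)$, the expression $f(w_\epsilon(x,p),p)$ means $\sum_{n\ge0}\frac{\epsilon^n}{n!}\tilde w_\epsilon^{i_1}\cdots\tilde w_\epsilon^{i_n}\big[\partial_{x^{i_1}}\cdots\partial_{x^{i_n}}f\big](w_0(x,p),p)$, extended $\epsilon$-linearly to formal series $f$; formal pullback of differential forms is defined accordingly. A formal symplectic realization $s_\epsilon:(T^*\mathbb{R}^d,\omega_0)\to(\mathbb{R}^d,\epsilon\pi)$ is a formal power series $s_\epsilon=x+\epsilon s_{(1)}+\epsilon^2 s_{(2)}+\cdots$ with smooth $\mathbb{R}^d$-valued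 coefficients on $T^*\mathbb{R}^d$ satisfying $\{s^i_\epsilon,s^j_\epsilon\}_{\omega_0}(x,p)=\epsilon\,\pi^{ij}(s_\epsilon(x,p))$ at each order in $\epsilon$. $\psi_{\overline V,\epsilon}$ is the formal map $(x,p)\mapsto(\phi_\epsilon(x,p),p)$. The formal Weinstein form $\omega_{\overline V,\epsilon}$ is the formal expansion in $\epsilon$ of $\frac1\epsilon\int_0^\epsilon(\varphi_s^{\overline V})^*\omega_0\,ds$, where $\varphi^{\overline V}_s$ is the flow of $\overline V$ on $T^*\mathbb{R}^d$, i.e. $\omega_{\overline V,\epsilon}=\sum_{n\ge0}\frac{\epsilon^n}{(n+1)!}L_{\overline V}^n\omega_0$ (Lie derivative of forms). The formal Karasev realization is the map $\alpha_\epsilon$. *)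

(* Defs.v *)
(* MathComp / MathComp-Analysis; the reals are an arbitrary R : realType. *)
From mathcomp Require Import all_boot all_order all_algebra.
From mathcomp Require Import boolp classical_sets functions reals.
From mathcomp Require Import topology normedtype derive.

Set Implicit Arguments.
Unset Strict Implicit.
Unset Printing Implicit Defensive.

Import Order.TTheory GRing.Theory Num.Theory.
Import numFieldNormedType.Exports.

Local Open Scope ring_scope.

(* C^oo: f and all its iterated directional derivatives are (Frechet)
   differentiable at every point. *)
Definition smooth (R : realType) (V : normedModType R) (f : V -> R) : Prop :=
  forall (vs : seq V) (x : V),
    differentiable (foldr (fun v (g : V -> R) => 'D_v g) f vs) x.

Section BasePoisson.
Variables (R : realType) (d : nat).
Implicit Types (f : 'rV[R]_d -> R) (pi : 'I_d -> 'I_d -> 'rV[R]_d -> R).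

Definition base_partial (l : 'I_d) f : 'rV[R]_d -> R :=
  'D_(delta_mx 0 l : 'rV[R]_d) f.

Definition jacobi_identity pi : Prop :=
  forall (i j k : 'I_d) (x : 'rV[R]_d),
    \sum_(l < d) (pi i l x * base_partial l (pi j k) x
                + pi j l x * base_partial l (pi k i) x
                + pi k l x * base_partial l (pi i j) x) = 0.

Definition poisson_structure pi : Prop :=
  [/\ forall i j, smooth (pi i j),
      forall i j x, pi i j x = - pi j i x
    & jacobi_identity pi].

End BasePoisson.

(* T^*R^d = R^d x R^d, a point being the pair z = (x, p). *)
Notation cotangent R d := ('rV[R]_d * 'rV[R]_d)%type.

(* The coordinates on T^*R^d are indexed by 'I_d + 'I_d:
   [inl i] stands for x^i and [inr i] for p_i. *)
Notation coord_index d := ('I_d + 'I_d)%type.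

Section Cotangent.
Variables (R : realType) (d : nat).
Local Notation T := (cotangent R d).
Local Notation I := (coord_index d).
Implicit Types (f g : T -> R) (V : I -> T -> R) (omega : I -> I -> T -> R).

Definition coordinate (a : I) : T -> R := fun z =>
  match a with inl i => z.1 0 i | inr i => z.2 0 i end.

Definition basis_vector (a : I) : T :=
  match a with inl i => (delta_mx 0 i, 0) | inr i => (0, delta_mx 0 i) end.

Definition partial (a : I) f : T -> R := 'D_(basis_vector a) f.

Definition iter_partial_x (s : seq 'I_d) f : T -> R :=
  foldr (fun i g => partial (inl i) g) f s.

Definition poisson_bracket f g : T -> R := fun z =>
  \sum_(i < d) (partial (inl i) f z * partial (inr i) g z
              - partial (inr i) f z * partial (inl i) g z).

(* A vector field is given by its components V^a. *)
Definition lie_fun V f : T -> R := fun z => \sum_(a : I) V a z * partial a f z.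

(* A 2-form is given by its components omega_ab = omega(d_a, d_b). Since
   [V, d_a] = - (d_a V^c) d_c, the Leibniz rule
   (L_V omega)(X, Y) = V(omega(X, Y)) - omega([V, X], Y) - omega(X, [V, Y])
   gives the components below. *)
Definition lie_form V omega : I -> I -> T -> R := fun a b z =>
  lie_fun V (omega a b) z
  + \sum_(c : I) (partial a (V c) z * omega c b z
                + partial b (V c) z * omega a c z).

(* dp_i /\ dx^i *)
Definition omega0 : I -> I -> T -> R := fun a b _ =>
  match a, b with
  | inr i, inl j => (i == j)%:R
  | inl i, inr j => - (i == j)%:R
  | _, _ => 0
  end.

(* F n is the coefficient of epsilon^n. *)
Definition fseries := nat -> T -> R.
Implicit Types (F G : fseries) (w : 'I_d -> fseries).

Definition fs_const f : fseries := fun n z => if n == 0%N then f z else 0.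

Definition fs_mul F G : fseries := fun n z =>
  \sum_(k < n.+1) F k z * G (n - k)%N z.

Definition fs_eps F : fseries := fun n z =>
  if n is m.+1 then F m z else 0.

Definition fs_bracket F G : fseries := fun n z =>
  \sum_(k < n.+1) poisson_bracket (F k) (G (n - k)%N) z.

(* (w_epsilon - w_0) / epsilon *)
Definition fs_tail F : fseries := fun n => F n.+1.

(* The expansion of f(w_epsilon(x,p), p): the term of multi-index
   s = (i_1, ..., i_n) is epsilon^n / n! times a power series, so only the
   n <= N contribute to epsilon^N. *)
Definition fs_comp_fun w f : fseries := fun N z =>
  \sum_(n < N.+1) n`!%:R^-1 *
    \sum_(s : n.-tuple 'I_d)
      (\big[fs_mul/fs_const (fun=> 1)]_(i <- s) fs_tail (w i)) (N - n)%N z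
      * iter_partial_x s f (\row_i w i 0%N z, z.2).

(* epsilon-linear extension *)
Definition fs_comp w F : fseries := fun N z =>
  \sum_(k < N.+1) fs_comp_fun w (F k) (N - k)%N z.

(* The components of the formal map (x,p) |-> (w(x,p), p). *)
Definition fiber_map w : I -> fseries := fun a =>
  match a with inl i => w i | inr i => fs_const (coordinate (inr i)) end.

Definition mutually_inverse (w v : 'I_d -> fseries) : Prop :=
  (forall a, fs_comp w (fiber_map v a) = fs_const (coordinate a)) /\
  (forall a, fs_comp v (fiber_map w a) = fs_const (coordinate a)).

(* Pullback of a formal 2-form by (x,p) |-> (w(x,p), p). *)
Definition fs_pullback w (omega : I -> I -> fseries) : I -> I -> fseries :=
  fun a b N z =>
    \sum_(c : I) \sum_(e : I)
      fs_mul (fs_comp w (omega c e))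
        (fs_mul (fun n => partial a (fiber_map w c n))
                (fun n => partial b (fiber_map w e n))) N z.

(* A formal series x + O(epsilon) of R^d-valued smooth functions. *)
Definition formal_near_projection w : Prop :=
  (forall i n, smooth (w i n)) /\ (forall i, w i 0%N = coordinate (inl i)).

Section Realizations.
Variable pi : 'I_d -> 'I_d -> 'rV[R]_d -> R.

Definition formal_symplectic_realization (s : 'I_d -> fseries) : Prop :=
  formal_near_projection s /\
  forall i j, fs_bracket (s i) (s j)
    = fs_eps (fs_comp s (fs_const (fun z => pi i j z.1))).

(* Vbar = - pi^{ij}(x) p_i d/dx^j *)
Definition Vbar (a : I) : T -> R := fun z =>
  match a with
  | inl j => - \sum_(i < d) pi i j z.1 * z.2 0 i
  | inr _ => 0
  end.

(* L_Vbar^n (x^i) *)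
Definition LVx (n : nat) (i : 'I_d) : T -> R :=
  iter n (lie_fun Vbar) (coordinate (inl i)).

Definition phi (i : 'I_d) : fseries := fun n z =>
  n.+1`!%:R^-1 * LVx n i z.

(* Formal expansion of
   epsilon^-1 * \int_0^epsilon (flow of Vbar at time s)^* omega0 ds. *)
Definition weinstein_form (a b : I) : fseries := fun n z =>
  n.+1`!%:R^-1 * iter n (lie_form Vbar) omega0 a b z.

Definition karasev_solution (alpha : 'I_d -> fseries) : Prop :=
  formal_near_projection alpha /\
  forall i, fs_comp alpha (phi i) = fs_const (coordinate (inl i)).

(* Each r k ranges over {0, ..., N}, which loses nothing since the r k are
   constrained to sum to N - n. *)
Definition karasev_recursion (alpha : 'I_d -> fseries) : Prop :=
  forall (N : nat) (i : 'I_d) (z : T), (1 <= N)%N ->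
    alpha i N z
    + \sum_(1 <= n < N) \sum_(1 <= m < (N - n).+1)
        \sum_(r : {ffun 'I_m -> 'I_N.+1} |
               [forall k, (1 <= r k)%N] && (\sum_(k < m) r k == N - n)%N)
          \sum_(s : m.-tuple 'I_d)
            (n.+1`!%:R * m`!%:R)^-1
            * (\prod_(k < m) alpha (tnth s k) (r k) z)
            * iter_partial_x s (LVx n i) z
    + N.+1`!%:R^-1 * LVx N i z = 0.

End Realizations.
End Cotangent.

(* Main.v *)
(* Write D for the derivation L_V, gamma^i = sum_n epsilon^n/n! D^n x^i for its
   flow and {,}_pi for the bracket of pi, in which the fibre coordinates p are
   mere parameters.  By the Jacobi identity D is a derivation of {,}_pi, and
   [d/dp_j, D] = {., x^j}_pi.  Integrating this along the flow gives
   d gamma^i/dp_j = {gamma^i, epsilon phi^j}_pi, and one more integration gives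
     d phi^i/dp_j - d phi^j/dp_i = epsilon {phi^i, phi^j}_pi.
   Together with the chain rule applied to phi(alpha(x,p),p) = x this is the
   symplectic realization property of alpha.  Moreover L_V p_i = 0 yields
   L_V^n omega_0 = dp_i /\ d(L_V^n x^i), so that the Weinstein form is the
   pullback of omega_0 by (phi, p), and pulling it back by (alpha, p) returns
   omega_0.  Finally phi = x + epsilon chi turns the equation for alpha into the
   fixed point equation alpha = x - epsilon chi(alpha). *)
Require Import Defs.
From HB Require Import structures.
From mathcomp Require Import all_boot all_order all_algebra.
From mathcomp Require Import boolp classical_sets functions reals.
From mathcomp Require Import topology normedtype derive.

Set Implicit Arguments.
Unset Strict Implicit.
Unset Printing Implicit Defensive.

Import Order.TTheory GRing.Theory Num.Theory.

(** * Formal power series *)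

(** The directional derivative is defined for every function, but linearity, the Leibniz rule and
    commutation of partials hold only under regularity assumptions. The calculus is therefore
    carried out over an abstract commutative algebra with commuting derivations dual to coordinates.
    Smooth functions on the cotangent space form such an algebra once mixed partials are known to
    commute, and the results are evaluated pointwise only at the end. A map x + O(epsilon) is
    represented by its displacement y from x, a series without constant term. Substituting x + y is
    then a Taylor sum whose n-th term has order at least n, so each coefficient receives finitely
    many contributions and substitution is an algebra endomorphism. Integration in epsilon becomes
    division of coefficients by n+1: identities are first multiplied by n+1 and then compared along
    antidiagonals. *)

Definition series (A : Type) := nat -> A.

Section SeriesRing.
Local Open Scope ring_scope.
Variables (R : comNzRingType) (A : comAlgType R).
Implicit Types F G H : series A.

HB.instance Definition _ := GRing.Lmodule.copy (series A) (nat -> A).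

Definition series_one : series A := fun n => (n == 0%N)%:R.

Definition series_mul F G : series A := fun n =>
  \sum_(k < n.+1) F k * G (n - k)%N.

Let trunc n F : {poly A} := \poly_(i < n.+1) F i.

(** A coefficient of a Cauchy product sees only truncations of the factors, so associativity is
    inherited from polynomials. *)
Let series_mulE n F G i : (i <= n)%N ->
  series_mul F G i = (trunc n F * trunc n G)`_i.
Proof.
move=> lein; rewrite coefM; apply: eq_bigr => j _.
rewrite !coef_poly !ltnS (leq_trans (leq_subr _ _) lein).
by rewrite (leq_trans _ lein)// -ltnS.
Qed.

Let series_mulA : associative series_mul.
Proof.
move=> F G H; apply/funext => n.
transitivity ((trunc n F * (trunc n G * trunc n H))`_n).
  rewrite coefM; apply: eq_bigr => j _.
  by rewrite coef_poly ltn_ord (series_mulE (n := n)) ?leq_subr.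
rewrite mulrA coefM; apply: eq_bigr => j _.
by rewrite (series_mulE (n := n)) -1?ltnS// [X in _ * X]coef_poly ltnS leq_subr.
Qed.

Let series_mulC : commutative series_mul.
Proof.
move=> F G; apply/funext => n; rewrite /series_mul.
rewrite (reindex_inj rev_ord_inj) /=; apply: eq_bigr => i _.
by rewrite subSS mulrC subKn// -ltnS.
Qed.

Let series_mul1 : left_id series_one series_mul.
Proof.
move=> F; apply/funext => n; rewrite /series_mul big_ord_recl /series_one eqxx.
by rewrite mul1r subn0 big1 ?addr0// => i _; rewrite mul0r.
Qed.

Let series_mulDl : left_distributive series_mul +%R.
Proof.
move=> F G H; apply/funext => n; rewrite /series_mul.
transitivity (\sum_(k < n.+1) (F k * H (n - k)%N + G k * H (n - k)%N)).
  by apply: eq_bigr => i _; rewrite -mulrDl.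
by rewrite big_split.
Qed.

Let series_one_neq0 : series_one != 0.
Proof.
by apply/eqP => /(congr1 (@^~ 0%N)) /eqP; rewrite oner_eq0.
Qed.

HB.instance Definition _ := GRing.Zmodule_isComNzRing.Build (series A)
  series_mulA series_mulC series_mul1 series_mulDl series_one_neq0.

Let series_scaleAl (a : R) (F G : series A) : a *: (F * G) = (a *: F) * G.
Proof.
apply/funext => n; rewrite /GRing.mul/= /series_mul.
transitivity (a *: \sum_(k < n.+1) F k * G (n - k)%N) => //.
by rewrite scaler_sumr; apply: eq_bigr => i _; rewrite scalerAl.
Qed.

HB.instance Definition _ := GRing.Lmodule_isLalgebra.Build R (series A)
  series_scaleAl.
HB.instance Definition _ := GRing.Lalgebra_isComAlgebra.Build R (series A).

Lemma coefSD F G n : (F + G) n = F n + G n. Proof. by []. Qed.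
Lemma coefSN F n : (- F) n = - F n. Proof. by []. Qed.
Lemma coefS0 n : (0 : series A) n = 0. Proof. by []. Qed.
Lemma coefSZ a F n : (a *: F) n = a *: F n. Proof. by []. Qed.
Lemma coefSM F G n : (F * G) n = \sum_(k < n.+1) F k * G (n - k)%N.
Proof. by []. Qed.
Lemma coefS_sum I r (P : pred I) (E : I -> series A) n :
  (\sum_(i <- r | P i) E i) n = \sum_(i <- r | P i) E i n.
Proof. by rewrite fct_sumE. Qed.

End SeriesRing.

(** * Sums over triangles and antidiagonals *)

Section TriangularSums.
Local Open Scope ring_scope.

Lemma sum_triangle (V : nmodType) N (G : nat -> nat -> V) :
  (forall k l, (k <= N)%N -> (l <= N)%N -> (N < k + l)%N -> G k l = 0) ->
  \sum_(n < N.+1) \sum_(k < n.+1) G k (n - k)%N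
    = \sum_(k < N.+1) \sum_(l < N.+1) G k l.
Proof.
move=> G0.
transitivity (\sum_(k < N.+1) \sum_(l < (N - k).+1) G k l); last first.
  apply: eq_bigr => k _.
  rewrite (big_ord_widen _ (fun l => G k l) (_ : (N - k).+1 <= N.+1)%N); last first.
    by rewrite ltnS leq_subr.
  rewrite big_mkcond/=; apply: eq_bigr => l _; case: ltnP => // ltkl.
  by rewrite G0 -1?ltnS// ltnS -ltn_subLR// -ltnS.
elim: N {G0} => [|N IH]; first by rewrite !big_ord_recl !big_ord0.
rewrite big_ord_recr/= {}IH [in RHS]big_ord_recr/= subnn big_ord1.
rewrite [X in _ + X]big_ord_recr/= subnn addrA; congr (_ + _).
rewrite -big_split; apply: eq_bigr => k _ /=.
by rewrite subSn -1?ltnS// [RHS]big_ord_recr.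
Qed.

(** On the antidiagonal k + l = N+1 the factor N+1 splits as k + l. This is the Leibniz rule for d/d
    epsilon in coefficients, and it drives the degree inductions below. *)
Lemma sum_antidiag_succ (V : nmodType) N (G : nat -> nat -> V) :
  (\sum_(k < N.+2) G k (N.+1 - k)%N) *+ N.+1 =
  \sum_(k < N.+1) G k.+1 (N - k)%N *+ k.+1
  + \sum_(k < N.+1) G k (N - k).+1 *+ (N - k).+1.
Proof.
rewrite -sumrMnl.
transitivity (\sum_(k < N.+2)
  (G k (N.+1 - k)%N *+ k + G k (N.+1 - k)%N *+ (N.+1 - k))).
  apply: eq_bigr => k _; rewrite -mulrnDr subnKC// -ltnS.
  exact: ltn_ord.
rewrite big_split/=; congr (_ + _).
  by rewrite big_ord_recl /= mulr0n add0r.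
rewrite big_ord_recr /= subnn mulr0n addr0; apply: eq_bigr => k _.
by rewrite subSn// -ltnS.
Qed.

End TriangularSums.

(** * Formal Taylor expansion *)

Lemma derivation1 (R : nzRingType) (B : comAlgType R) (D : {linear B -> B}) :
  (forall F G : B, D (F * G) = D F * G + F * D G)%R -> D 1%R = 0%R.
Proof.
move=> DM; have := DM 1%R 1%R; rewrite !mulr1 mul1r => /eqP.
by rewrite -subr_eq0 opprD addNKr oppr_eq0 => /eqP.
Qed.

Section Taylor.
Local Open Scope ring_scope.
Variables (R : realType) (B : comAlgType R) (d : nat).
Variable dx : 'I_d -> {linear B -> B}.
Hypothesis dxM : forall i (F G : B), dx i (F * G) = dx i F * G + F * dx i G.
Hypothesis dxC : forall i j F, dx i (dx j F) = dx j (dx i F).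
Implicit Types (y : 'I_d -> B) (F G : B) (L : B -> B).

(* (y . d)^n / n! followed by L, the factors y_i being treated as constants *)
Fixpoint taylor L y n F : B :=
  if n is m.+1 then (m.+1%:R^-1 : R) *: \sum_i y i * taylor L y m (dx i F)
  else L F.

Lemma mulrn_scaleV n (F : B) : ((n.+1%:R^-1 : R) *: F) *+ n.+1 = F.
Proof. by rewrite -scaler_nat scalerA divff ?scale1r// pnatr_eq0. Qed.

Lemma mulrnSI n (F G : B) : F *+ n.+1 = G *+ n.+1 -> F = G.
Proof.
rewrite -!(scaler_nat n.+1) => /(congr1 ( *:%R (n.+1%:R^-1 : R))).
by rewrite !scalerA mulVf ?pnatr_eq0// !scale1r.
Qed.

Lemma taylorS L y n F :
  taylor L y n.+1 F *+ n.+1 = \sum_i y i * taylor L y n (dx i F).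
Proof. exact: mulrn_scaleV. Qed.

Lemma eq_taylor L L' y y' n : L =1 L' -> y =1 y' ->
  taylor L y n =1 taylor L' y' n.
Proof.
move=> eL ey; elim: n => [|n IH] F //=.
by under eq_bigr => i _ do rewrite IH ey.
Qed.

Lemma taylor_linear (L : {linear B -> B}) y n : linear (taylor L y n).
Proof.
elim: n => [|n IH] a F G /=; first exact: linearP.
rewrite [a *: (_ *: _)]scalerA [a * _]mulrC -scalerA -scalerDr; congr (_ *: _).
rewrite scaler_sumr -big_split; apply: eq_bigr => i _.
by rewrite linearP IH mulrDr scalerAr.
Qed.

HB.instance Definition _ (L : {linear B -> B}) y n :=
  GRing.isLinear.Build R B B *:%R (taylor L y n) (taylor_linear L y n).

(** Leibniz rule for divided powers: after multiplication by the degree one factor y.d is peeled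
    off, and it hits either [F] or [G]. *)
Lemma taylorM y n F G : taylor idfun y n (F * G) =
  \sum_(k < n.+1) taylor idfun y k F * taylor idfun y (n - k) G.
Proof.
elim: n F G => [|n IH] F G; first by rewrite big_ord1.
apply: (@mulrnSI n); rewrite taylorS.
rewrite (sum_antidiag_succ n
  (fun k l => taylor idfun y k F * taylor idfun y l G)).
under eq_bigr => i _ do rewrite dxM linearD/= !IH mulrDr.
rewrite big_split; congr (_ + _).
  under eq_bigr => i _ do rewrite mulr_sumr.
  rewrite exchange_big; apply: eq_bigr => k _.
  rewrite -mulrnAl taylorS mulr_suml; apply: eq_bigr => i _.
  by rewrite mulrA.
under eq_bigr => i _ do rewrite mulr_sumr.
rewrite exchange_big; apply: eq_bigr => k _.
rewrite -mulrnAr taylorS mulr_sumr; apply: eq_bigr => i _.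
by rewrite mulrCA.
Qed.

(** Since the y_i act as constants and the partials commute, z.d can be moved from the outside to
    the innermost slot. *)
Let taylor_dx L y z n F :
  \sum_i z i * taylor L y n (dx i F)
  = taylor (fun G => \sum_i z i * L (dx i G)) y n F.
Proof.
elim: n F => [|n IH] F //=.
under eq_bigr => i _ do rewrite -scalerAr mulr_sumr.
rewrite -scaler_sumr exchange_big/=; congr (_ *: _); apply: eq_bigr => j _.
by rewrite -IH mulr_sumr; apply: eq_bigr => i _; rewrite mulrCA dxC.
Qed.

Let taylorMn L y n k F : taylor L y n F *+ k = taylor (fun G => L G *+ k) y n F.
Proof.
elim: n F => [|n IH] F //=; rewrite scalerMnr -sumrMnl.
by congr (_ *: _); apply: eq_bigr => i _; rewrite -IH mulrnAr.
Qed.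

(** Binomial formula for divided powers. The power of z.d sits in the slot [L] of the power of y.d,
    so that neither displacement gets differentiated. *)
Lemma taylorD L y z n F : taylor L (fun i => y i + z i) n F =
  \sum_(k < n.+1) taylor (taylor L z (n - k)) y k F.
Proof.
elim: n F => [|n IH] F; first by rewrite big_ord1.
apply: (@mulrnSI n); rewrite taylorS.
rewrite (sum_antidiag_succ n (fun k l => taylor (taylor L z l) y k F)).
under eq_bigr => i _ do rewrite mulrDl !IH !mulr_sumr.
rewrite big_split; congr (_ + _); rewrite exchange_big; apply: eq_bigr => k _ /=.
  by rewrite taylorS.
rewrite taylorMn taylor_dx; apply: eq_taylor => // G.
by rewrite taylorS.
Qed.

(** [D] reaches either [F] or one of the n factors y_i; the n equal choices turn 1/n! into
    1/(n-1)!. *)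
Lemma taylor_derivation (D : {linear B -> B}) y n F :
  (forall F G : B, D (F * G) = D F * G + F * D G) ->
  (forall i F, D (dx i F) = dx i (D F)) ->
  D (taylor idfun y n F) = taylor idfun y n (D F)
    + (if n is m.+1 then \sum_i D (y i) * taylor idfun y m (dx i F) else 0).
Proof.
move=> DM Ddx; elim: n F => [|n IH] F; first by rewrite /= addr0.
apply: (@mulrnSI n); rewrite mulrnDl -raddfMn !taylorS raddf_sum/=.
under eq_bigr => i _ do rewrite DM IH mulrDr Ddx.
rewrite !big_split/= addrCA; congr (_ + _).
rewrite mulrS; congr (_ + _); case: n {IH} => [|n].
  by rewrite big1// => i _; rewrite mulr0.
rewrite -sumrMnl; under [RHS]eq_bigr => i _ do rewrite -mulrnAr taylorS mulr_sumr.
rewrite exchange_big; apply: eq_bigr => i _; rewrite mulr_sumr.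
by apply: eq_bigr => j _; rewrite dxC mulrCA.
Qed.

Lemma taylor_hom (C : {linear B -> B}) L y n F :
  (forall F G : B, C (F * G) = C F * C G) ->
  C (taylor L y n F) = taylor (C \o L) (C \o y) n F.
Proof.
move=> CM; elim: n F => [|n IH] F //=; rewrite linearZ raddf_sum/=.
by under eq_bigr => i _ do rewrite CM IH.
Qed.

End Taylor.

(** * Composition of formal power series *)

Section SeriesOrder.
Local Open Scope ring_scope.
Variables (R : realType) (A : comAlgType R).
Implicit Types (F G : series A) (t u : nat -> series A).

Definition smap (D : A -> A) F : series A := fun n => D (F n).

Lemma smap_linear (D : {linear A -> A}) : linear (smap D).
Proof. by move=> a F G; apply/funext => n; rewrite /smap linearP. Qed.

HB.instance Definition _ (D : {linear A -> A}) :=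
  GRing.isLinear.Build R (series A) (series A) *:%R (smap D) (smap_linear D).

Lemma smapM (D : {linear A -> A}) : (forall f g : A, D (f * g) = D f * g + f * D g) ->
  forall F G : series A, smap D (F * G) = smap D F * G + F * smap D G.
Proof.
move=> DM F G; apply/funext => n; rewrite /smap coefSD !coefSM raddf_sum.
by rewrite -big_split; apply: eq_bigr => i _ /=; rewrite DM.
Qed.

Definition ord_ge k F := forall j, (j < k)%N -> F j = 0.

Lemma ord_geD k F G : ord_ge k F -> ord_ge k G -> ord_ge k (F + G).
Proof. by move=> kF kG j jk; rewrite coefSD kF ?kG ?addr0. Qed.

Lemma ord_geZ k a F : ord_ge k F -> ord_ge k (a *: F).
Proof. by move=> kF j jk; rewrite coefSZ kF ?scaler0. Qed.

Lemma ord_ge_sum I r (P : pred I) (E : I -> series A) k :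
  (forall i, P i -> ord_ge k (E i)) -> ord_ge k (\sum_(i <- r | P i) E i).
Proof. by move=> kE j jk; rewrite coefS_sum big1// => i Pi; rewrite kE. Qed.

Lemma ord_geM k l F G : ord_ge k F -> ord_ge l G -> ord_ge (k + l) (F * G).
Proof.
move=> kF lG j jkl; rewrite coefSM big1// => i _.
case: (ltnP i k) => [ik|ki]; first by rewrite kF// mul0r.
rewrite (lG (j - i)%N) ?mulr0// ltn_subLR -1?ltnS//.
by apply: leq_trans jkl _; rewrite leq_add2r.
Qed.

Lemma ord_geW k l F : (k <= l)%N -> ord_ge l F -> ord_ge k F.
Proof. by move=> kl lF j jk; apply: lF; apply: leq_trans kl. Qed.

Lemma ord_ge_smap (D : {linear A -> A}) k F : ord_ge k F -> ord_ge k (smap D F).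
Proof. by move=> kF j jk; rewrite /smap kF// linear0. Qed.

(* The sum of a family t for which t n = O(epsilon^n). *)
Definition ssum t : series A := fun N => \sum_(n < N.+1) t n N.

Lemma ssum_coef t N M : (forall n, ord_ge n (t n)) -> (N <= M)%N ->
  ssum t N = \sum_(n < M.+1) t n N.
Proof.
move=> tn NM; rewrite /ssum (big_ord_widen M.+1 (fun n => t n N)) ?ltnS//.
rewrite big_mkcond; apply: eq_bigr => n _; case: ltnP => // Nn.
by rewrite (tn n).
Qed.

Lemma eq_ssum t u : t =1 u -> ssum t = ssum u.
Proof. by move=> tu; congr ssum; apply/funext. Qed.

(** Up to a remainder invisible at order N the sum is finite, so a linear operator that does not
    lower orders can be moved inside [ssum]. *)
Lemma ssum_split t N : (forall n, ord_ge n (t n)) ->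
  exists2 F, ord_ge N.+1 F & ssum t = \sum_(n < N.+1) t n + F.
Proof.
move=> tn; exists (ssum t - \sum_(n < N.+1) t n); last by rewrite addrC subrK.
by move=> j jN; rewrite coefSD coefSN coefS_sum (ssum_coef tn (M := N))// subrr.
Qed.

Lemma ssumZ a t : a *: ssum t = ssum (fun n => a *: t n).
Proof. by apply/funext => N; rewrite coefSZ scaler_sumr. Qed.

Lemma ssumD t u : ssum t + ssum u = ssum (fun n => t n + u n).
Proof. by apply/funext => N; rewrite coefSD -big_split. Qed.

Lemma ssumMl F t : (forall n, ord_ge n (t n)) ->
  F * ssum t = ssum (fun n => F * t n).
Proof.
move=> tn; apply/funext => N; rewrite coefSM.
under eq_bigr => k _ do rewrite (ssum_coef tn (leq_subr _ _)) mulr_sumr.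
by rewrite exchange_big.
Qed.

Lemma ssum_sum I r (P : pred I) (t : I -> nat -> series A) :
  \sum_(i <- r | P i) ssum (t i) = ssum (fun n => \sum_(i <- r | P i) t i n).
Proof.
apply/funext => N; rewrite coefS_sum exchange_big; apply: eq_bigr => n _.
by rewrite coefS_sum.
Qed.

Lemma ssum_ssum (t : nat -> nat -> series A) :
  (forall n m, ord_ge (n + m) (t n m)) ->
  ssum (fun n => ssum (t n)) = ssum (fun n => \sum_(k < n.+1) t k (n - k)%N).
Proof.
move=> tnm; apply/funext => N; rewrite /ssum.
under [RHS]eq_bigr => n _ do rewrite coefS_sum.
rewrite (sum_triangle (G := fun k l => t k l N))// => k l _ _ Nkl.
exact: (tnm k l).
Qed.

Lemma smap_ssum (D : {linear A -> A}) t :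
  smap D (ssum t) = ssum (fun n => smap D (t n)).
Proof. by apply/funext => N; rewrite /smap /ssum raddf_sum. Qed.

Lemma ssum_shift t : (forall n, ord_ge n.+1 (t n)) ->
  ssum (fun n => if n is m.+1 then t m else 0) = ssum t.
Proof.
move=> tn; apply/funext => N; rewrite /ssum big_ord_recl.
by rewrite [X in X + _](_ : _ = 0)// add0r [RHS]big_ord_recr/= (tn N N) ?addr0.
Qed.

Definition epsilon : series A := fun n => (n == 1%N)%:R.

Lemma coef_epsilonM F n : (epsilon * F) n = if n is m.+1 then F m else 0.
Proof.
rewrite coefSM; case: n => [|n]; first by rewrite big_ord1 mul0r.
rewrite big_ord_recl mul0r add0r big_ord_recl mul1r subSS subn0.
by rewrite big1 ?addr0// => i _; rewrite mul0r.
Qed.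

End SeriesOrder.

Section Composition.
Local Open Scope ring_scope.
Variables (R : realType) (A : comAlgType R) (d : nat).
Variable dx : 'I_d -> {linear A -> A}.
Hypothesis dxM : forall i (f g : A), dx i (f * g) = dx i f * g + f * dx i g.
Hypothesis dxC : forall i j f, dx i (dx j f) = dx j (dx i f).
Implicit Types (y : 'I_d -> series A) (F G : series A).

Let sdx i : {linear series A -> series A} := smap (dx i).
Let sdxM i F G : sdx i (F * G) = sdx i F * G + F * sdx i G.
Proof. exact: smapM. Qed.
Let sdxC i j F : sdx i (sdx j F) = sdx j (sdx i F).
Proof. by apply/funext => n; rewrite /= /smap dxC. Qed.

Local Notation tayl := (taylor sdx).

Definition small y := forall i, ord_ge 1 (y i).

Lemma ord_ge_taylor (L : series A -> series A) y m n F : small y ->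
  (forall G, ord_ge m (L G)) -> ord_ge (n + m) (tayl L y n F).
Proof.
move=> y1 Lm; elim: n F => [|n IH] F //=; apply: ord_geZ.
by apply: ord_ge_sum => i _; rewrite addSn -add1n; apply: ord_geM.
Qed.

Lemma ord_ge_taylor_id y n F : small y -> ord_ge n (tayl idfun y n F).
Proof.
by move=> y1; have := @ord_ge_taylor idfun y 0 n F y1; rewrite addn0; apply.
Qed.

Lemma ord_ge_taylor_arg y n k F : ord_ge k F -> ord_ge k (tayl idfun y n F).
Proof.
elim: n F => [|n IH] F kF //=; apply: ord_geZ; apply: ord_ge_sum => i _.
by rewrite -[k]add0n; apply: ord_geM => //; apply/IH/ord_ge_smap.
Qed.

(* F(x + y(x,p), p) *)
Definition scomp y F : series A := ssum (fun n => tayl idfun y n F).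

Lemma scomp_linear y : linear (scomp y).
Proof.
move=> a F G; rewrite ssumZ ssumD; apply: eq_ssum => n.
exact: (linearP (taylor sdx idfun y n)).
Qed.

HB.instance Definition _ y :=
  GRing.isLinear.Build R (series A) (series A) *:%R (scomp y) (scomp_linear y).

Lemma ord_ge_comp y k F : ord_ge k F -> ord_ge k (scomp y F).
Proof.
move=> kF j jk; rewrite /scomp /ssum big1// => n _.
exact: (@ord_ge_taylor_arg y n k F kF).
Qed.

(** The product of the two Taylor sums, regrouped by total degree, is the Leibniz rule [taylorM] in
    each degree. *)
Lemma scompM y F G : small y -> scomp y (F * G) = scomp y F * scomp y G.
Proof.
move=> y1; rewrite /scomp (ssumMl _ (fun n => @ord_ge_taylor_id y n G y1)).
under [RHS]eq_ssum => n do rewrite mulrC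
  (ssumMl _ (fun n => @ord_ge_taylor_id y n F y1)).
rewrite ssum_ssum; last first.
  by move=> n m; apply: ord_geM; apply: ord_ge_taylor_id.
apply: eq_ssum => n; rewrite taylorM// [RHS](reindex_inj rev_ord_inj).
by apply: eq_bigr => i _ /=; rewrite subSS subKn -1?ltnS// mulrC.
Qed.

Lemma scomp_ssum y t : small y -> (forall n, ord_ge n (t n)) ->
  scomp y (ssum t) = ssum (fun n => scomp y (t n)).
Proof.
move=> y1 tn; apply/funext => N.
have [F NF ->] := ssum_split N tn.
rewrite linearD raddf_sum/= coefSD (ord_ge_comp y NF)// addr0 coefS_sum.
by [].
Qed.

Lemma scomp_derivation (D : {linear A -> A}) y F : small y ->
  (forall f g : A, D (f * g) = D f * g + f * D g) ->
  (forall i f, D (dx i f) = dx i (D f)) ->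
  smap D (scomp y F) = scomp y (smap D F)
    + \sum_i smap D (y i) * scomp y (smap (dx i) F).
Proof.
move=> y1 DM Ddx; rewrite smap_ssum.
have sDM := smapM DM.
have sDdx i G : smap D (sdx i G) = sdx i (smap D G).
  by apply/funext => n; rewrite /= /smap Ddx.
rewrite (eq_ssum (fun n => taylor_derivation sdxC y n F sDM sDdx)).
rewrite -ssumD; congr (_ + _).
(* The factor [smap D (y i)] has order 1, so t n has order n+1 and lowering the summation index by
   one adds nothing to any coefficient. *)
pose t n := \sum_i smap D (y i) * tayl idfun y n (sdx i F).
rewrite -/(ssum _) (ssum_shift (t := t)); last first.
  move=> n; apply: ord_ge_sum => i _; rewrite -add1n.
  by apply: ord_geM; [apply: ord_ge_smap | apply: ord_ge_taylor_id].
under [RHS]eq_bigr => i _ do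
  rewrite (ssumMl _ (fun n => @ord_ge_taylor_id y n _ y1)).
by rewrite ssum_sum.
Qed.

(** Following x + y by x + v gives the displacement y + v(x + y, p). Substitution is multiplicative,
    so it passes inside each Taylor term, and the resulting double sum collapses by the binomial
    formula [taylorD]. *)
Lemma scomp_comp y v F : small y -> small v ->
  scomp y (scomp v F) = scomp (fun i => scomp y (v i) + y i) F.
Proof.
move=> y1 v1; pose u i := scomp y (v i).
have u1 : small u by move=> i; apply: ord_ge_comp.
rewrite [scomp v F]/scomp scomp_ssum//; last by move=> n; apply: ord_ge_taylor_id.
transitivity (ssum (fun n => ssum (fun m => tayl (tayl idfun y m) u n F))).
  apply: eq_ssum => n;
    rewrite (@taylor_hom _ _ _ sdx (scomp y) idfun v n F (fun F G => scompM F G y1))/=.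
  elim: n F => [|n IH] F //=; rewrite -ssumZ -ssum_sum; congr (_ *: _).
  apply: eq_bigr => i _; rewrite IH ssumMl// => m.
  rewrite -/(ord_ge _ _); apply: ord_geW (leq_addl n m) _.
  by apply: ord_ge_taylor => // G; apply: ord_ge_taylor_id.
rewrite ssum_ssum; last first.
  by move=> n m; apply: ord_ge_taylor => // G; apply: ord_ge_taylor_id.
by apply: eq_ssum => n; rewrite taylorD.
Qed.

Lemma scomp_epsilonM y F : small y -> scomp y (epsilon A * F) = epsilon A * scomp y F.
Proof.
move=> y1; rewrite scompM//; congr (_ * _); apply/funext => N.
rewrite /scomp /ssum big_ord_recl big1 ?addr0// => n _ /=.
rewrite big1 ?scaler0// => i _; rewrite (_ : sdx i _ = 0) ?linear0 ?mulr0//.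
apply/funext => k; rewrite /= /smap /epsilon coefS0.
by case: (k == 1)%N; rewrite ?(derivation1 (dxM i)) ?linear0.
Qed.

(** Substitution is non-expansive in the displacement for the epsilon-adic distance; an extra factor
    epsilon then makes the fixed point map a contraction. *)
Lemma ord_ge_comp_sub k y z F : small z ->
  (forall i, ord_ge k (y i - z i)) -> ord_ge k (scomp y F - scomp z F).
Proof.
move=> z1 yz.
have key n G : ord_ge k (tayl idfun y n G - tayl idfun z n G).
  elim: n G => [|n IH] G /=; first by rewrite subrr.
  rewrite -scalerBr -sumrB; apply: ord_geZ; apply: ord_ge_sum => i _.
  rewrite -(subrK (z i) (y i)) mulrDl -addrA -mulrBr.
  apply: ord_geD; first by rewrite -[k]addn0; apply: ord_geM.
  by rewrite -[k]add0n; apply: ord_geM.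
move=> j jk; rewrite coefSD coefSN -sumrB big1// => n _.
exact: (key n F j jk).
Qed.

(** Epsilon-adic contraction principle: iterating [K] from 0 fixes one more coefficient at each
    step. *)
Lemma fixpoint_exists (chi : 'I_d -> series A) :
  exists2 y, small y & forall i, y i = - (epsilon A * scomp y (chi i)).
Proof.
pose K y : 'I_d -> series A := fun i => - (epsilon A * scomp y (chi i)).
pose Y n := iter n K (fun=> 0).
have epsK k y z i : small z -> (forall i, ord_ge k (y i - z i)) ->
    ord_ge k.+1 (K y i - K z i).
  move=> z1 yz; rewrite /K -opprD -mulrBr -mulrN => j jk.
  rewrite coef_epsilonM; case: j jk => [|j]// jk; rewrite coefSN.
  by rewrite (ord_ge_comp_sub _ z1 yz) ?oppr0.
have Ks y : small (K y).
  by move=> i [|j]// _; rewrite /K coefSN coef_epsilonM oppr0.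
have Ys n : small (Y n) by case: n => [|n]; [move=> i j|apply: Ks].
have YS n i : ord_ge n.+1 (Y n.+1 i - Y n i).
  elim: n i => [|n IH] i; last exact: epsK.
  by rewrite subr0; exact: Ks.
(* The coefficient N no longer changes from the iterate [Y N] on, so the limit is read off the
   diagonal. *)
pose y i N := Y N i N.
have yY n i j : (j <= n)%N -> Y n i j = y i j.
  elim: n => [|n IH]; first by rewrite leqn0 => /eqP ->.
  rewrite leq_eqVlt => /predU1P[->//|jn]; rewrite -IH//.
  apply/eqP; rewrite -subr_eq0; apply/eqP.
  by have := YS n i j jn.
have ys : small y by move=> i [|j]// _.
exists y => // i; apply/funext => N.
have yYN j : ord_ge N (Y N j - y j).
  by move=> l lN; rewrite coefSD coefSN yY ?subrr// ltnW.
have /(_ N (leqnn _))/eqP := epsK N (Y N) y i ys yYN.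
rewrite coefSD coefSN subr_eq0 => /eqP E.
by rewrite -[RHS]/(K y i N) -E -(yY N.+1 i N).
Qed.

Lemma fixpoint_unique (chi y z : 'I_d -> series A) :
  small y -> small z -> (forall i, y i = - (epsilon A * scomp y (chi i))) ->
  (forall i, z i = - (epsilon A * scomp z (chi i))) -> y = z.
Proof.
move=> y1 z1 yE zE; suff yz k i : ord_ge k (y i - z i).
  apply/funext => i; apply/funext => N; apply/eqP; rewrite -subr_eq0.
  exact/eqP/(yz N.+1 i N).
elim: k i => [//|k IH] i [|j] jk.
  by rewrite coefSD coefSN y1 ?z1 ?subrr.
rewrite yE zE -opprD -mulrBr coefSN coef_epsilonM.
by rewrite (ord_ge_comp_sub _ z1 IH) ?oppr0.
Qed.

End Composition.

(** * Series constant in epsilon *)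

Section ConstantSeries.
Local Open Scope ring_scope.
Variables (R : realType) (A : comAlgType R).
Implicit Types (f g : A) (F G : series A).

Definition sconst f : series A := fun n => if n == 0%N then f else 0.

Lemma sconst_linear : linear sconst.
Proof.
move=> a f g; apply/funext => -[|n] //=.
by rewrite coefSD coefSZ /= scaler0 addr0.
Qed.

HB.instance Definition _ :=
  GRing.isLinear.Build R A (series A) *:%R sconst sconst_linear.

Lemma coef_sconstM f F n : (sconst f * F) n = f * F n.
Proof.
rewrite coefSM big_ord_recl subn0 big1 ?addr0// => i _.
by rewrite mul0r.
Qed.

Lemma sconstM f g : sconst (f * g) = sconst f * sconst g.
Proof.
apply/funext => n; rewrite coef_sconstM /sconst.
by case: (n == 0%N); rewrite ?mulr0.
Qed.

Lemma sconst1 : sconst 1 = 1.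
Proof. by apply/funext => -[|n]. Qed.

Lemma smap_sconst (D : {linear A -> A}) f : smap D (sconst f) = sconst (D f).
Proof. by apply/funext => -[|n] //=; rewrite /smap /= linear0. Qed.

End ConstantSeries.

(** * The symplectic realization in an algebra with coordinate derivations *)

Section FormalRealization.
Local Open Scope ring_scope.
Variables (R : realType) (A : comAlgType R) (d : nat).
Local Notation I := ('I_d + 'I_d)%type.
Variable dA : I -> {linear A -> A}.
Hypothesis dAM : forall a (f g : A), dA a (f * g) = dA a f * g + f * dA a g.
Hypothesis dAC : forall a b (f : A), dA a (dA b f) = dA b (dA a f).
Variable coord : I -> A.
Hypothesis dA_coord : forall a b, dA a (coord b) = (a == b)%:R.
Variable pi : 'I_d -> 'I_d -> A.
Hypothesis dp_pi : forall k i j, dA (inr k) (pi i j) = 0.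
Hypothesis pi_anti : forall i j, pi i j = - pi j i.
Hypothesis pi_jacobi : forall i j k,
  \sum_l (pi i l * dA (inl l) (pi j k) + pi j l * dA (inl l) (pi k i)
          + pi k l * dA (inl l) (pi i j)) = 0.
Implicit Types (f g : A) (F G : series A) (y v : 'I_d -> series A).

Local Notation dx i := (dA (inl i)).
Local Notation dp i := (dA (inr i)).
Local Notation X i := (coord (inl i)).
Local Notation P i := (coord (inr i)).

Let dxX k i : dx k (X i) = (k == i)%:R. Proof. exact: dA_coord. Qed.
Let dpX k i : dp k (X i) = 0. Proof. exact: dA_coord. Qed.
Let dxP k i : dx k (P i) = 0. Proof. exact: dA_coord. Qed.
Let dpP k i : dp k (P i) = (k == i)%:R. Proof. exact: dA_coord. Qed.

Lemma sum_coord (V : nmodType) (E : I -> V) :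
  \sum_a E a = \sum_i E (inl i) + \sum_i E (inr i).
Proof. by rewrite big_sumType. Qed.

Definition valg (a : I) : A :=
  match a with inl j => - \sum_i pi i j * P i | inr _ => 0 end.

Definition lieA f : A := \sum_a valg a * dA a f.

Local Notation V j := (valg (inl j)).

Let lieAE f : lieA f = \sum_j V j * dx j f.
Proof.
rewrite /lieA sum_coord [Z in _ + Z]big1 ?addr0// => i _.
by rewrite mul0r.
Qed.

Lemma lieA_linear : linear lieA.
Proof.
move=> a f g; rewrite /lieA scaler_sumr -big_split; apply: eq_bigr => i _ /=.
by rewrite linearP mulrDr scalerAr.
Qed.

HB.instance Definition _ := GRing.isLinear.Build R A A *:%R lieA lieA_linear.

Lemma lieAM f g : lieA (f * g) = lieA f * g + f * lieA g.
Proof.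
rewrite /lieA mulr_suml mulr_sumr -big_split; apply: eq_bigr => i _ /=.
by rewrite dAM mulrDr mulrA [in RHS]mulrCA.
Qed.

Lemma dA_lieA a f : dA a (lieA f) = lieA (dA a f) + \sum_c dA a (valg c) * dA c f.
Proof.
rewrite /lieA raddf_sum addrC -big_split; apply: eq_bigr => i _ /=.
by rewrite dAM dAC.
Qed.

(** * The bracket of pi on functions of x, with p as parameters *)

Definition pb f g : A := \sum_k \sum_l pi k l * (dx k f * dx l g).

Lemma pbDl f f' g : pb (f + f') g = pb f g + pb f' g.
Proof.
rewrite /pb -big_split; apply: eq_bigr => k _; rewrite -big_split.
by apply: eq_bigr => l _; rewrite /= linearD mulrDl mulrDr.
Qed.

Lemma pbC f g : pb f g = - pb g f.
Proof.
rewrite /pb exchange_big -sumrN; apply: eq_bigr => k _.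
rewrite -sumrN; apply: eq_bigr => l _.
by rewrite pi_anti mulNr [dx l f * _]mulrC.
Qed.

Lemma pbMn f g n : pb (f *+ n) g = pb f g *+ n.
Proof.
elim: n => [|n IH]; last by rewrite !mulrS pbDl IH.
rewrite !mulr0n /pb big1// => k _; rewrite big1// => l _.
by rewrite linear0 mul0r mulr0.
Qed.

Lemma pbMnr f g n : pb f (g *+ n) = pb f g *+ n.
Proof. by rewrite pbC pbMn -mulNrn -pbC. Qed.

(** The field V^k = - pi^{ik} p_i is linear in p, with dV^k/dp_j = - pi^{jk} = pi^{kj}, which is the
    k-th component of the derivation {., x^j}. *)
Lemma dp_lieA j f : dp j (lieA f) = lieA (dp j f) + pb f (X j).
Proof.
rewrite dA_lieA; congr (_ + _); rewrite sum_coord [Z in _ + Z]big1 ?addr0; last first.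
  by move=> i _; rewrite linear0 mul0r.
rewrite /pb; apply: eq_bigr => k _.
rewrite [RHS](bigD1 j)// [Z in _ = _ + Z]big1 ?addr0; last first.
  by move=> l lj; rewrite dxX (negbTE lj) !mulr0.
rewrite dxX eqxx mulr1; congr (_ * _).
rewrite linearN raddf_sum/= (bigD1 j)//= big1 ?addr0; last first.
  move=> l lj; rewrite dAM dp_pi mul0r add0r dpP.
  by rewrite eq_sym (negbTE lj) mulr0.
by rewrite dAM dp_pi mul0r add0r dpP eqxx mulr1 -pi_anti.
Qed.

(* lieA is the Hamiltonian derivation of the linear function p_i x^i of x,
   whence the role of the Jacobi identity. *)
Lemma lieA_pi k l :
  lieA (pi k l) = \sum_m (pi m l * dx m (V k) + pi k m * dx m (V l)).
Proof.
rewrite lieAE.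
have dxV m j : dx m (V j) = - \sum_i dx m (pi i j) * P i.
  rewrite linearN raddf_sum; congr (- _); apply: eq_bigr => i _.
  by rewrite /= dAM dxP mulr0 addr0.
have -> : \sum_j V j * dx j (pi k l)
    = \sum_i - (\sum_j (pi i j * dx j (pi k l))) * P i.
  under eq_bigr => j _ do rewrite mulNr mulr_suml -sumrN.
  rewrite exchange_big; apply: eq_bigr => i _.
  rewrite mulNr mulr_suml -sumrN; apply: eq_bigr => j _.
  by rewrite mulrAC.
under [RHS]eq_bigr => m _ do
  rewrite !dxV !mulrN -opprD !mulr_sumr -big_split -sumrN.
rewrite exchange_big; apply: eq_bigr => i _ /=.
under [RHS]eq_bigr => j _ do rewrite !mulrA -mulrDl -mulNr.
rewrite -mulr_suml sumrN; congr (- _ * _); apply/eqP.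
(* The coefficients of [P i] on both sides differ by exactly the Jacobi expression for (i, k, l). *)
rewrite -subr_eq0 -sumrB; apply/eqP; rewrite -[RHS](pi_jacobi i k l).
apply: eq_bigr => j _.
by rewrite opprD (pi_anti l i) (pi_anti l j) linearN mulrN mulNr addrAC !addrA.
Qed.

Lemma lieA_pb f g : lieA (pb f g) = pb (lieA f) g + pb f (lieA g).
Proof.
have dxL k h : dx k (lieA h) = lieA (dx k h) + \sum_m dx k (V m) * dx m h.
  rewrite dA_lieA sum_coord [Z in _ + (_ + Z)]big1 ?addr0// => i _.
  by rewrite linear0 mul0r.
(* [E1] and [E2] relabel indices so that the commutator terms become coefficients of d_k f d_l g,
   the form in which [lieA_pi] absorbs them. *)
have E1 : \sum_k \sum_l pi k l * ((\sum_m dx k (V m) * dx m f) * dx l g)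
    = \sum_k \sum_l (\sum_m pi m l * dx m (V k)) * (dx k f * dx l g).
  under eq_bigr => k _ do under eq_bigr => l _ do
    rewrite mulr_suml mulr_sumr.
  under [RHS]eq_bigr => k _ do under eq_bigr => l _ do rewrite mulr_suml.
  under eq_bigr => k _ do rewrite exchange_big.
  rewrite exchange_big; apply: eq_bigr => k _.
  rewrite exchange_big; apply: eq_bigr => l _.
  by apply: eq_bigr => m _; rewrite !mulrA.
have E2 : \sum_k \sum_l pi k l * (dx k f * (\sum_m dx l (V m) * dx m g))
    = \sum_k \sum_l (\sum_m pi k m * dx m (V l)) * (dx k f * dx l g).
  apply: eq_bigr => k _.
  under eq_bigr => l _ do rewrite !mulr_sumr.
  rewrite exchange_big; apply: eq_bigr => l _; rewrite mulr_suml.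
  apply: eq_bigr => m _; rewrite -!mulrA; congr (_ * _).
  by rewrite mulrCA.
have -> : pb (lieA f) g + pb f (lieA g) =
   \sum_k \sum_l (pi k l * (lieA (dx k f) * dx l g + dx k f * lieA (dx l g)))
   + (\sum_k \sum_l pi k l * ((\sum_m dx k (V m) * dx m f) * dx l g)
     + \sum_k \sum_l pi k l * (dx k f * (\sum_m dx l (V m) * dx m g))).
  rewrite /pb -!big_split; apply: eq_bigr => k _.
  rewrite -!big_split; apply: eq_bigr => l _ /=.
  rewrite !dxL mulrDl [dx k f * (_ + _)]mulrDr !mulrDr.
  by rewrite -!addrA; congr (_ + _); rewrite addrCA.
rewrite E1 E2 -!big_split /pb raddf_sum; apply: eq_bigr => k _ /=.
rewrite -!big_split raddf_sum; apply: eq_bigr => l _ /=.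
rewrite lieAM lieAM lieA_pi addrC; congr (_ + _).
by rewrite -mulrDl big_split.
Qed.


(** * The flow of V, its time average phi, and their p-derivatives *)

Definition lie_iter n i : A := iter n lieA (X i).

Definition phiA i : series A := fun n => (n.+1`!%:R^-1 : R) *: lie_iter n i.

Let gam i n : A := (n`!%:R^-1 : R) *: lie_iter n i.

(** The flow equation d gamma/d epsilon = D gamma in coefficients. In the same way [phi_gam] says
    that epsilon phi has derivative gamma. *)
Let gamS i n : gam i n.+1 *+ n.+1 = lieA (gam i n).
Proof.
rewrite /gam linearZ /= -scaler_nat scalerA; congr (_ *: _).
by rewrite factS natrM invfM mulrA divff ?mul1r// pnatr_eq0.
Qed.

Let phi_gam i n : phiA i n *+ n.+1 = gam i n.
Proof.
rewrite /gam /phiA -scaler_nat scalerA; congr (_ *: _).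
by rewrite factS natrM invfM mulrA divff ?mul1r// pnatr_eq0.
Qed.

Let lieA_phi i n : lieA (phiA i n) = phiA i n.+1 *+ n.+2.
Proof.
rewrite phi_gam /gam /phiA linearZ /=; congr (_ *: _).
Qed.

Let phi0 i : phiA i 0%N = X i.
Proof. by rewrite /phiA (_ : 1`! = 1)%N// invr1 scale1r. Qed.

(* d(gamma^i)/dp_j = {gamma^i, epsilon phi^j}, where gamma is the flow of lieA
   and epsilon phi its integral from 0 to epsilon. *)
Let dp_gam i j n :
  dp j (gam i n.+1) = \sum_(k < n.+1) pb (gam i (n - k)%N) (phiA j k).
Proof.
have gam0 k : gam k 0%N = X k by rewrite /gam fact0 invr1 scale1r.
elim: n => [|n IH].
  rewrite big_ord1 gam0 phi0 -[gam _ _]mulr1n gamS gam0 dp_lieA dpX linear0 add0r.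
  by [].
apply: (@mulrnSI R A n.+1).
have -> : dp j (gam i n.+2) *+ n.+2 = dp j (lieA (gam i n.+1)).
  by rewrite -gamS raddfMn.
(* Of the n+2 copies of the sum, n+1 split along the antidiagonal. The spare copy supplies the term
   {gamma^i, x^j} at k = 0 and raises each factor k+1 to the k+2 required by [lieA_phi]. *)
rewrite dp_lieA IH raddf_sum/= mulrSr.
rewrite (sum_antidiag_succ n (fun k l => pb (gam i l) (phiA j k))).
rewrite [Z in _ = _ + Z]big_ord_recl subn0 phi0.
rewrite [pb _ (X j) + _]addrC addrA; congr (_ + _).
under eq_bigr => k _ do rewrite lieA_pb -gamS lieA_phi pbMn pbMnr.
rewrite big_split/= addrC addrAC; congr (_ + _).
rewrite -big_split; apply: eq_bigr => k _ /=.
by rewrite [bump _ _]add1n subSS -mulrSr.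
Qed.

Definition pb_series F G : series A :=
  \sum_k \sum_l sconst (pi k l) * (smap (dx k) F * smap (dx l) G).

Let coef_pb_series F G n :
  pb_series F G n = \sum_(k < n.+1) pb (F (n - k)%N) (G k).
Proof.
rewrite /pb_series /pb coefS_sum [RHS]exchange_big; apply: eq_bigr => k _ /=.
rewrite coefS_sum [RHS]exchange_big; apply: eq_bigr => l _ /=.
rewrite coef_sconstM coefSM mulr_sumr (reindex_inj rev_ord_inj).
apply: eq_bigr => i _ /=.
by rewrite subSS subKn// -ltnS.
Qed.

(** Since gamma_m = (m+1) phi_m, reversing the second sum gives {phi^i_{n-k}, phi^j_k} the
    multiplicity (n-k+1) + (k+1) = n+2, which cancels the factor n+2 coming from phi = gamma/(n+2)
    in degree n+1. *)
Lemma dp_phi i j :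
  smap (dp j) (phiA i) - smap (dp i) (phiA j)
  = epsilon A * pb_series (phiA i) (phiA j).
Proof.
apply/funext => n; rewrite coefSD coefSN coef_epsilonM /smap.
case: n => [|n]; first by rewrite !phi0 !dpX subr0.
rewrite coef_pb_series; apply: (@mulrnSI R A n.+1).
have dpphi l m : dp l (phiA m n.+1) *+ n.+2 = dp l (gam m n.+1).
  by rewrite -phi_gam raddfMn.
rewrite mulrnBl !dpphi !dp_gam.
rewrite -sumrMnl [Z in _ - Z](reindex_inj rev_ord_inj) -sumrB.
apply: eq_bigr => k _ /=.
have kn : (k <= n)%N by rewrite -ltnS.
rewrite subSS subKn// [pb (gam j k) _]pbC opprK -!phi_gam pbMn pbMnr -mulrnDr.
by rewrite addSn addnS subnK.
Qed.


(** * Substitution into coordinates and the formal inverse of phi *)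

Local Notation cmp := (scomp (fun i => dA (inl i))).

Let dxM i (f g : A) : dx i (f * g) = dx i f * g + f * dx i g.
Proof. exact: dAM. Qed.
Let dxC i j (f : A) : dx i (dx j f) = dx j (dx i f).
Proof. exact: dAC. Qed.

Let taylor_const y n F : (forall i, smap (dx i) F = 0) ->
  taylor (fun i => smap (dx i)) idfun y n.+1 F = 0.
Proof.
by move=> F0 /=; rewrite big1 ?scaler0// => i _; rewrite F0 linear0 mulr0.
Qed.

Lemma scomp_const y F : (forall i, smap (dx i) F = 0) -> cmp y F = F.
Proof.
move=> F0; apply/funext => N; rewrite /scomp /ssum big_ord_recl big1 ?addr0//.
by move=> n _; rewrite lift0 taylor_const.
Qed.

Lemma scomp_zero F : cmp (fun=> 0) F = F.
Proof.
apply/funext => N; rewrite /scomp /ssum big_ord_recl big1 ?addr0// => n _ /=.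
by rewrite big1 ?scaler0// => i _; rewrite mul0r.
Qed.

Lemma scomp_coord y i : small y -> cmp y (sconst (X i)) = sconst (X i) + y i.
Proof.
move=> y1; apply/funext => N; rewrite /scomp.
(* One extra term is added to the sum so that the degrees 0 and 1 can both be split off, even for N
   = 0. *)
rewrite (ssum_coef (fun n => @ord_ge_taylor_id _ _ _ _ y n _ y1) (leqnSn N)).
have dX j : smap (dx j) (sconst (X i)) = sconst (j == i)%:R.
  by rewrite smap_sconst dxX.
have T2 n : taylor (fun j => smap (dx j)) idfun y n.+2 (sconst (X i)) = 0.
  transitivity ((n.+2%:R^-1 : R) *: \sum_j
    y j * taylor (fun j => smap (dx j)) idfun y n.+1 (smap (dx j) (sconst (X i)))).
    by [].
  rewrite big1 ?scaler0// => j _.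
  rewrite taylor_const ?mulr0// => k; rewrite dX smap_sconst.
  by rewrite raddfMn /= (derivation1 (dxM k)) mul0rn linear0.
rewrite !big_ord_recl big1 ?addr0; last by move=> n _; rewrite !lift0 T2.
rewrite coefSD; congr (_ + _); rewrite /= invr1 scale1r (bigD1 i)//= big1 ?addr0.
  by rewrite dX eqxx sconst1 mulr1.
by move=> j /negbTE ji; rewrite dX ji linear0 mulr0.
Qed.


(* The components of the formal map (x, p) |-> (x + y(x, p), p). *)
Definition fmapA y (c : I) : series A :=
  match c with inl i => sconst (X i) + y i | inr i => sconst (P i) end.

Lemma scomp_chain y a F : small y ->
  smap (dA a) (cmp y F) = \sum_c cmp y (smap (dA c) F) * smap (dA a) (fmapA y c).
Proof.
move=> y1; rewrite (scomp_derivation dxC F y1 (dAM a) (fun i => dAC a (inl i))).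
have dacoord c : smap (dA a) (sconst (coord c)) = sconst (a == c)%:R.
  by rewrite smap_sconst dA_coord.
transitivity (\sum_c cmp y (smap (dA c) F) * sconst (a == c)%:R
  + \sum_i cmp y (smap (dx i) F) * smap (dA a) (y i)).
  congr (_ + _); last by apply: eq_bigr => i _; rewrite mulrC.
  rewrite (bigD1 a)//= eqxx sconst1 mulr1 big1 ?addr0// => c.
  by rewrite eq_sym => /negbTE ->; rewrite linear0 mulr0.
rewrite !sum_coord addrAC -big_split/=; congr (_ + _); apply: eq_bigr => i _ /=.
  by rewrite linearD/= dacoord mulrDr.
by rewrite dacoord.
Qed.

Definition solA y := small y /\ forall i, cmp y (phiA i) = sconst (X i).

Let phiA_split i :
  phiA i = sconst (X i) + epsilon A * (fun n => phiA i n.+1).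
Proof.
apply/funext => -[|n]; rewrite coefSD coef_epsilonM /= ?addr0 ?add0r//.
Qed.

Let sol_fixpoint y : small y -> (forall i, cmp y (phiA i) = sconst (X i)) <->
  (forall i, y i = - (epsilon A * cmp y (fun n => phiA i n.+1))).
Proof.
move=> y1; have E i : cmp y (phiA i) =
    sconst (X i) + (y i + epsilon A * cmp y (fun n => phiA i n.+1)).
  by rewrite [in LHS]phiA_split linearD/= scomp_coord// scomp_epsilonM// addrA.
split=> H i; have := H i; rewrite E.
  by move/eqP; rewrite -subr_eq0 addrAC subrr add0r addr_eq0 => /eqP.
by move=> {1}->; rewrite addNr addr0.
Qed.

Lemma solA_exists : exists y, solA y.
Proof.
have [y y1 yE] := fixpoint_exists (fun i => dA (inl i)) (fun i n => phiA i n.+1).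
by exists y; split => //; apply/sol_fixpoint.
Qed.

Lemma solA_unique y z : solA y -> solA z -> y = z.
Proof.
move=> [y1 yE] [z1 zE].
by apply: (fixpoint_unique y1 z1 (chi := fun i n => phiA i n.+1));
  apply/sol_fixpoint.
Qed.

Definition phi_tail i : series A := phiA i - sconst (X i).

Lemma phi_tail_small : small phi_tail.
Proof. by move=> i [|n]// _; rewrite /phi_tail coefSD coefSN phi0 subrr. Qed.

(** The equation phi(x + y, p) = x says that the composite displacement is zero. *)
Lemma scomp_phi_tail y F : solA y -> cmp y (cmp phi_tail F) = F.
Proof.
move=> [y1 yE]; rewrite scomp_comp//; last exact: phi_tail_small.
rewrite -[RHS]scomp_zero; congr (scomp _ _ F); apply/funext => i.
by rewrite linearB/= yE scomp_coord// opprD addNKr addNr.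
Qed.

(** Taylor terms of positive degree raise the order, so substitution preserves the leading
    coefficient. *)
Lemma scomp_inj y F : small y -> cmp y F = 0 -> F = 0.
Proof.
move=> y1 yF; suff Fk k : ord_ge k F by apply/funext => n; rewrite (Fk n.+1).
elim: k => [//|k IH] j; rewrite ltnS leq_eqVlt => /predU1P[->|]; last exact: IH.
have := congr1 (@^~ k) yF; rewrite /scomp /ssum big_ord_recl big1 ?addr0// => n _.
rewrite lift0 /= coefSZ coefS_sum big1 ?scaler0// => i _.
have : ord_ge (1 + k) (y i * taylor (fun i => smap (dx i)) idfun y n (smap (dx i) F)).
  by apply: ord_geM => //; apply/ord_ge_taylor_arg/ord_ge_smap.
by move=> /(_ k (ltnSn _)).
Qed.

(** The second composition order follows from the first by applying the injective map [cmp y] to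
    both sides. *)
Lemma phi_tail_comp y F : solA y -> cmp phi_tail (cmp y F) = F.
Proof.
move=> sy; apply/eqP; rewrite -subr_eq0; apply/eqP/(@scomp_inj y); first by case: sy.
by rewrite linearB/= scomp_phi_tail// subrr.
Qed.

Lemma scomp_P y i : cmp y (sconst (P i)) = sconst (P i).
Proof. by apply: scomp_const => k; rewrite smap_sconst dxP linear0. Qed.

Lemma fmapA_scomp y c : small y -> cmp y (sconst (coord c)) = fmapA y c.
Proof. by case: c => i y1; rewrite /= ?scomp_coord ?scomp_P. Qed.

Lemma phiA_fmap c : fmapA phi_tail c =
  if c is inl i then phiA i else sconst (coord c).
Proof. by case: c => i //=; rewrite addrC subrK. Qed.

Lemma sol_inverse y c : solA y ->
  cmp phi_tail (fmapA y c) = sconst (coord c)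
  /\ cmp y (fmapA phi_tail c) = sconst (coord c).
Proof.
move=> sy; have [y1 yE] := sy; split; first by rewrite -fmapA_scomp// phi_tail_comp.
by case: c => i; rewrite phiA_fmap ?scomp_P.
Qed.

(** * Lie derivatives and pullback of the symplectic form *)

Definition lie_formA (om : I -> I -> A) : I -> I -> A := fun a b =>
  lieA (om a b) + \sum_c (dA a (valg c) * om c b + dA b (valg c) * om a c).

(* dp_i /\ d(L_V^n x^i) *)
Definition omA n : I -> I -> A := fun a b =>
  \sum_i (dA a (P i) * dA b (lie_iter n i) - dA b (P i) * dA a (lie_iter n i)).

(** In components: L_V commutes with d and obeys the Leibniz rule on the tensor product of df and
    dg. *)
Let lie_tensor f g a b :
  lieA (dA a f * dA b g)
  + \sum_c (dA a (valg c) * (dA c f * dA b g) + dA b (valg c) * (dA a f * dA c g))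
  = dA a (lieA f) * dA b g + dA a f * dA b (lieA g).
Proof.
rewrite !dA_lieA lieAM mulrDl mulrDr addrACA; congr (_ + _).
rewrite big_split mulr_suml mulr_sumr; congr (_ + _); apply: eq_bigr => c _ /=.
  by rewrite mulrA.
by rewrite mulrCA.
Qed.

Let lieA_P i : lieA (P i) = 0.
Proof.
by rewrite /lieA sum_coord !big1 ?addr0// => j _; rewrite ?dxP ?mulr0// mul0r.
Qed.

Lemma lie_formA_omA n : lie_formA (omA n) = omA n.+1.
Proof.
apply/funext => a; apply/funext => b; rewrite /lie_formA /omA raddf_sum/=.
under [Z in _ + Z]eq_bigr => c _ do rewrite !mulr_sumr -big_split.
rewrite [Z in _ + Z]exchange_big -big_split/=; apply: eq_bigr => i _.
have E := lie_tensor (P i) (lie_iter n i).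
have Ea := E a b; have Eb := E b a.
rewrite lieA_P !linear0 !mul0r !add0r in Ea Eb.
rewrite -Ea -Eb linearB/= opprD addrACA; congr (_ + _); rewrite -sumrB.
apply: eq_bigr => c _; rewrite !mulrBr addrACA -opprD; congr (_ - _).
by rewrite addrC; congr (_ * _ + _ * _); rewrite mulrC.
Qed.

Lemma iter_lie_formA n : iter n lie_formA (omA 0) = omA n.
Proof. by elim: n => //= n ->; rewrite lie_formA_omA. Qed.

Definition weinsteinA a b : series A := fun n =>
  (n.+1`!%:R^-1 : R) *: omA n a b.

Let weinsteinAE a b : weinsteinA a b =
  \sum_i (smap (dA a) (sconst (P i)) * smap (dA b) (phiA i)
          - smap (dA b) (sconst (P i)) * smap (dA a) (phiA i)).
Proof.
apply/funext => n; rewrite coefS_sum /weinsteinA /omA scaler_sumr.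
apply: eq_bigr => i _; rewrite coefSD coefSN !smap_sconst !coef_sconstM.
by rewrite scalerBr !scalerAr /smap /phiA !linearZ.
Qed.

Lemma pullback_weinstein y a b : solA y ->
  \sum_c \sum_e cmp y (weinsteinA c e)
    * (smap (dA a) (fmapA y c) * smap (dA b) (fmapA y e)) = sconst (omA 0 a b).
Proof.
move=> [y1 yE].
(* Pullback commutes with d and with products, so dp_i /\ d phi^i is sent to dp_i /\ d(phi^i(x + y,
   p)) = dp_i /\ dx^i. *)
have pull F G : \sum_c \sum_e cmp y (smap (dA c) F * smap (dA e) G)
      * (smap (dA a) (fmapA y c) * smap (dA b) (fmapA y e))
    = smap (dA a) (cmp y F) * smap (dA b) (cmp y G).
  rewrite !scomp_chain// mulr_suml; apply: eq_bigr => c _.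
  rewrite mulr_sumr; apply: eq_bigr => e _.
  by rewrite scompM// mulrACA.
transitivity (\sum_i
  (smap (dA a) (cmp y (sconst (P i))) * smap (dA b) (cmp y (phiA i))
  - smap (dA b) (cmp y (sconst (P i))) * smap (dA a) (cmp y (phiA i)))); last first.
  under eq_bigr => i _ do
    rewrite scomp_P yE !smap_sconst -!sconstM -linearB/=.
  by rewrite -raddf_sum.
under eq_bigr => c _ do under eq_bigr => e _ do
  rewrite weinsteinAE raddf_sum mulr_suml.
under eq_bigr => c _ do rewrite exchange_big.
rewrite exchange_big; apply: eq_bigr => i _.
rewrite -pull [smap (dA b) _ * _]mulrC -pull -sumrB; apply: eq_bigr => c _.
rewrite -sumrB; apply: eq_bigr => e _ /=.
by rewrite linearB/= mulrBl [smap (dA e) (sconst _) * _]mulrC.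
Qed.

(** Let a, b be the x- and p-Jacobians of x + y, and M, B those of phi evaluated at (x + y, p).
    Differentiating phi(x + y, p) = x gives M a = 1 and M b = - B. Hence S = a b^T - b a^T satisfies
    M S M^T = B - B^T, and [dp_phi] identifies this with M Pi M^T. A left inverse of a square matrix
    over a commutative ring is two-sided, so M cancels. *)
Lemma solA_bracket y i j : solA y ->
  \sum_l (smap (dx l) (fmapA y (inl i)) * smap (dp l) (fmapA y (inl j))
          - smap (dp l) (fmapA y (inl i)) * smap (dx l) (fmapA y (inl j)))
  = epsilon A * cmp y (sconst (pi i j)).
Proof.
move=> [y1 yE].
pose a : 'M[series A]_d := \matrix_(k, l) smap (dx l) (fmapA y (inl k)).
pose b : 'M[series A]_d := \matrix_(k, l) smap (dp l) (fmapA y (inl k)).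
pose M : 'M[series A]_d := \matrix_(i, k) cmp y (smap (dx k) (phiA i)).
pose B : 'M[series A]_d := \matrix_(i, k) cmp y (smap (dp k) (phiA i)).
pose Pi : 'M[series A]_d := \matrix_(i, j) (epsilon A * cmp y (sconst (pi i j))).
pose S := a *m b^T - b *m a^T.
suff : S = Pi.
  move/matrixP => /(_ i j); rewrite !mxE => <-; rewrite -sumrB.
  by apply: eq_bigr => l _; rewrite !mxE.
have Ma : M *m a = 1%:M.
  apply/matrixP => k l; rewrite !mxE.
  have := scomp_chain (inl l) (phiA k) y1.
  rewrite yE sum_coord [Z in _ + Z]big1 ?addr0; last first.
    by move=> m _; rewrite smap_sconst dxP linear0 mulr0.
  rewrite smap_sconst dxX eq_sym => /esym E.
  have -> : ((k == l)%:R : series A) = sconst (k == l)%:R.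
    by rewrite raddfMn /= sconst1.
  by rewrite -E; apply: eq_bigr => m _; rewrite !mxE.
have Mb : M *m b = - B.
  apply/matrixP => k l; rewrite !mxE.
  have := scomp_chain (inr l) (phiA k) y1.
  rewrite yE smap_sconst dpX linear0 sum_coord addrC => /esym/eqP.
  rewrite addr_eq0 => /eqP E.
  rewrite (bigD1 l)//= big1 in E; last first.
    by move=> m /negbTE ml; rewrite smap_sconst dpP eq_sym ml linear0 mulr0.
  rewrite smap_sconst dpP eqxx sconst1 mulr1 addr0 in E.
  by rewrite E opprK; apply: eq_bigr => m _; rewrite !mxE.
have BPi : B - B^T = M *m Pi *m M^T.
  apply/matrixP => k l; rewrite !mxE.
  rewrite -linearB/= dp_phi scomp_epsilonM// /pb_series raddf_sum mulr_sumr /=.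
  under eq_bigr => m _ do rewrite raddf_sum mulr_sumr /=.
  rewrite exchange_big; apply: eq_bigr => m _; rewrite !mxE mulr_suml.
  apply: eq_bigr => n _; rewrite !mxE /= !scompM// !mulrA; congr (_ * _).
  by rewrite mulrC mulrA.
have aM : a *m M = 1%:M by apply: mulmx1C.
have MSM : M *m S *m M^T = M *m Pi *m M^T.
  rewrite -BPi /S mulmxBr mulmxBl !mulmxA Ma Mb mul1mx -!mulmxA -!trmx_mul.
  by rewrite Ma Mb trmx1 mulmx1 opprK linearN /= addrC.
have TM : M^T *m a^T = 1%:M by rewrite -trmx_mul aM trmx1.
have := congr1 (fun Z => a *m Z *m a^T) MSM.
by rewrite -!mulmxA TM !mulmx1 !mulmxA aM !mul1mx.
Qed.

End FormalRealization.

(** * Coefficients of compositions *)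

Section Coefficients.
Local Open Scope ring_scope.

Lemma sum_tuple_cons (V : nmodType) (J : finType) n (G : n.+1.-tuple J -> V) :
  \sum_(s : n.+1.-tuple J) G s = \sum_i \sum_(s : n.-tuple J) G [tuple of i :: s].
Proof.
rewrite pair_big (reindex (fun p : J * n.-tuple J => [tuple of p.1 :: p.2]))//.
exists (fun s => (thead s, [tuple of behead s])) => [[i s] _|s _] /=.
  by congr pair; apply: val_inj.
by apply: val_inj; rewrite /= [in RHS](tuple_eta s).
Qed.

Variables (R : realType) (A : comAlgType R).
Implicit Types F G : series A.

(** Unfolds the recursive Taylor operator into the multi-index sum that defines formal
    composition. *)
Lemma taylor_tuple (B : comAlgType R) d (dx : 'I_d -> {linear B -> B}) y n (F : B) :
  (forall i j (F : B), dx i (dx j F) = dx j (dx i F)) ->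
  taylor dx idfun y n F = (n`!%:R^-1 : R) *:
    \sum_(s : n.-tuple 'I_d) (\prod_(i <- s) y i) * foldr (fun i => dx i) F s.
Proof.
move=> dxC; elim: n F => [|n IH] F.
  rewrite fact0 invr1 scale1r (big_pred1 [tuple]) ?big_nil ?mul1r//.
  by move=> s; rewrite [s]tuple0 [RHS]eqxx.
have dxs i (s : seq 'I_d) (G : B) :
    foldr (fun i => dx i) (dx i G) s = dx i (foldr (fun i => dx i) G s).
  by elim: s => //= j s ->; rewrite dxC.
rewrite /= factS natrM invfM -scalerA; congr (_ *: _).
rewrite sum_tuple_cons scaler_sumr; apply: eq_bigr => i _; rewrite IH -scalerAr.
congr (_ *: _); rewrite mulr_sumr; apply: eq_bigr => s _.
by rewrite big_cons /= dxs mulrA.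
Qed.

Lemma coef_epsilonXM k F n :
  (epsilon A ^+ k * F) n = if (k <= n)%N then F (n - k)%N else 0.
Proof.
elim: k n => [|k IH] n; first by rewrite mul1r subn0.
by rewrite exprS -mulrA coef_epsilonM; case: n.
Qed.

Lemma series_trunc F N :
  ord_ge N.+1 (F - \sum_(k < N.+1) epsilon A ^+ k * sconst (F k)).
Proof.
move=> j jN; rewrite coefSD coefSN coefS_sum (bigD1 (Ordinal jN))//= big1 => [|k kj].
  by rewrite coef_epsilonXM leqnn subnn addr0 subrr.
rewrite coef_epsilonXM; case: leqP => // kj'; rewrite /sconst subn_eq0.
case: leqP => // jk; case/eqP: kj; apply: val_inj => /=.
by apply/eqP; rewrite eqn_leq kj'.
Qed.

Lemma ord_ge_sub_prod J (r : seq J) (F G : J -> series A) N :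
  (forall j, ord_ge N (F j - G j)) ->
  ord_ge N (\prod_(j <- r) F j - \prod_(j <- r) G j).
Proof.
move=> FG; elim: r => [|j r IH]; first by rewrite !big_nil subrr.
rewrite !big_cons -(subrK (F j * \prod_(j <- r) G j) (F j * _)) -mulrBr -addrA.
rewrite -mulrBl; apply: ord_geD; first by rewrite -[N]add0n; apply: ord_geM.
by rewrite -[N]addn0; apply: ord_geM.
Qed.

(** Modulo epsilon^(N+1) each factor is a finite sum of monomials of positive degree. Distributing
    the product gives one monomial per exponent function r, and the coefficient M selects those of
    total degree M. *)
Lemma coef_prod m (F : 'I_m -> series A) M N : (M <= N)%N ->
  (forall k, ord_ge 1 (F k)) ->
  (\prod_(k < m) F k) M =
  \sum_(r : {ffun 'I_m -> 'I_N.+1} |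
         [forall k, (1 <= r k)%N] && (\sum_(k < m) r k == M)%N)
    \prod_(k < m) F k (r k).
Proof.
move=> MN F1.
have trF k : ord_ge N.+1
    (F k - \sum_(j < N.+1 | (1 <= j)%N) epsilon A ^+ j * sconst (F k j)).
  have := @series_trunc (F k) N; rewrite [X in _ - X](bigD1 ord0)//= F1//.
  rewrite linear0 mulr0 add0r.
  by rewrite (eq_bigl (fun j : 'I_N.+1 => (1 <= j)%N))// => j; rewrite lt0n.
have /(_ M) := ord_ge_sub_prod (index_enum 'I_m) trF.
rewrite ltnS => /(_ MN)/eqP; rewrite coefSD coefSN subr_eq0 => /eqP ->.
rewrite (bigA_distr_big _ (fun k (j : 'I_N.+1) => epsilon A ^+ j * sconst (F k j))) /=.
rewrite coefS_sum big_mkcond [RHS]big_mkcond; apply: eq_bigr => r _.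
have -> : (r \in ffun_on (fun j : 'I_N.+1 => (1 <= j)%N))
    = [forall k, (1 <= r k)%N] by apply/ffun_onP/forallP.
case: [forall _, _] => //=.
rewrite big_split/= prodrXr coef_epsilonXM.
rewrite -(big_morph _ (@sconstM R A) (@sconst1 R A)) /sconst subn_eq0.
by rewrite eqn_leq; case: (leqP (\sum_(k < m) r k)%N M).
Qed.

Lemma scomp_coef d (dx : 'I_d -> {linear A -> A}) y F N :
  (forall i (f g : A), dx i (f * g) = dx i f * g + f * dx i g) -> small y ->
  scomp dx y F N = \sum_(k < N.+1) scomp dx y (sconst (F k)) (N - k)%N.
Proof.
move=> dxM y1; have compE k G :
    scomp dx y (epsilon A ^+ k * G) = epsilon A ^+ k * scomp dx y G.
  elim: k => [|k IH]; first by rewrite !mul1r.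
  by rewrite exprS -!mulrA scomp_epsilonM// IH.
have := ord_ge_comp dx y (@series_trunc F N) (ltnSn N).
rewrite linearB raddf_sum/= coefSD coefSN => /eqP; rewrite subr_eq0 => /eqP ->.
rewrite coefS_sum; apply: eq_bigr => k _.
by rewrite compE coef_epsilonXM -ltnS ltn_ord.
Qed.

End Coefficients.

Import numFieldNormedType.Exports.

(** * Smooth functions *)

Section Smooth.
Local Open Scope classical_set_scope.
Local Open Scope ring_scope.
Variables (R : realType) (V : normedModType R).
Implicit Types (f g : V -> R) (x u v : V).

Lemma smooth_differentiable f x : smooth f -> differentiable f x.
Proof. by move=> /(_ [::]). Qed.

Lemma smooth_derivable f x v : smooth f -> derivable f x v.
Proof. by move=> fs; apply/diff_derivable/smooth_differentiable. Qed.

Lemma smooth_derive f v : smooth f -> smooth ('D_v f).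
Proof.
move=> fs vs x; have := fs (rcons vs v) x.
by rewrite foldr_rcons.
Qed.

(** Coinduction for smoothness: it suffices to exhibit a class of differentiable functions stable
    under all directional derivatives. *)
Lemma smooth_coind (S : (V -> R) -> Prop) :
  (forall f, S f -> (forall x, differentiable f x) /\ forall v, S ('D_v f)) ->
  forall f, S f -> smooth f.
Proof.
move=> Scl f Sf vs x.
suff Sg : S (foldr (fun v (g : V -> R) => 'D_v g) f vs) by have [] := Scl _ Sg.
by elim: vs => //= v vs IH; have [_] := Scl _ IH.
Qed.

(** The derivative of a product is a sum of products, so smooth products alone are not a stable
    class; their closure under sums and products is. *)
Inductive smooth_alg : (V -> R) -> Prop :=
| smooth_alg_base f : smooth f -> smooth_alg f
| smooth_algD f g : smooth_alg f -> smooth_alg g -> smooth_alg (f + g)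
| smooth_algM f g : smooth_alg f -> smooth_alg g -> smooth_alg (f * g).

Lemma smooth_algP f : smooth_alg f -> smooth f.
Proof.
apply: smooth_coind => {}f; elim=> {f}[f fs|f g _ [df Df] _ [dg Dg]|f g fs [df Df] gs [dg Dg]].
- split=> [x|v]; first exact: smooth_differentiable.
  exact/smooth_alg_base/smooth_derive.
- split=> [x|v]; first exact: differentiableD.
  rewrite (_ : 'D_v (f + g) = 'D_v f + 'D_v g); first exact: smooth_algD.
  by apply/funext => x; rewrite deriveD//; apply: diff_derivable.
- split=> [x|v]; first exact: differentiableM.
  rewrite (_ : 'D_v (f * g) = f * 'D_v g + g * 'D_v f).
    by apply: smooth_algD; apply: smooth_algM.
  by apply/funext => x; rewrite deriveM//; apply: diff_derivable.
Qed.

Lemma smoothD f g : smooth f -> smooth g -> smooth (f + g).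
Proof.
by move=> fs gs; apply/smooth_algP/smooth_algD; apply: smooth_alg_base.
Qed.

Lemma smoothM f g : smooth f -> smooth g -> smooth (f * g).
Proof.
by move=> fs gs; apply/smooth_algP/smooth_algM; apply: smooth_alg_base.
Qed.

Lemma smooth_cst (c : R) : smooth (cst c : V -> R).
Proof.
apply: (@smooth_coind (fun f => exists c : R, f = cst c)); last by exists c.
move=> f [{}c ->]; split=> [x|v]; first exact: differentiable_cst.
by exists 0; apply/funext => x; rewrite derive_cst.
Qed.

Lemma smooth_derive_cst f : (forall x, differentiable f x) ->
  (forall v, exists c : R, 'D_v f = cst c) -> smooth f.
Proof.
move=> df Df; apply: (@smooth_coind (fun g => g = f \/ smooth g)); last by left.
move=> g [->|gs]; split=> //.
- by move=> v; right; have [c ->] := Df v; exact: smooth_cst.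
- by move=> x; exact: smooth_differentiable.
- by move=> v; right; exact: smooth_derive.
Qed.

Lemma is_derive_line f v y (s : R) : differentiable f (s *: v + y) ->
  is_derive s 1 (fun t : R => f (t *: v + y)) ('D_v f (s *: v + y)).
Proof.
move=> df.
have E : (fun h : R => h^-1 *: ((fun t : R => f (t *: v + y)) (h *: 1 + s)
    - f (s *: v + y)))
  = (fun h : R => h^-1 *: (f (h *: v + (s *: v + y)) - f (s *: v + y))).
  by apply/funext => h; rewrite scalerDl [h%:A]mulr1 addrA.
have dv : derivable f (s *: v + y) v by exact: diff_derivable.
split; first by rewrite /derivable /comp /shift /= in dv *; rewrite E.
by rewrite /derive /comp /shift /=; rewrite E.
Qed.

Let MVT_line f v y (h : R) : (forall x, differentiable f x) -> 0 < h ->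
  exists2 s : R, 0 <= s <= h & f (h *: v + y) - f y = h * 'D_v f (s *: v + y).
Proof.
move=> df h0.
have d s := @is_derive_line f v y s (df _).
have [|s sh] := @MVT R _ (fun s : R => 'D_v f (s *: v + y)) 0 h h0 (fun s _ => d s).
  apply: continuous_subspaceT => s; apply/differentiable_continuous.
  by apply/derivable1_diffP; have [] := d s.
rewrite scale0r add0r subr0 => ->; exists s; last by rewrite mulrC.
by move: sh; rewrite in_itv/= => /andP[/ltW -> /ltW ->].
Qed.

(** The mean value theorem along u for the increment z |-> f(h v + z) - f z, then along v for D_u
    f. *)
Let second_difference f u v x (h : R) : smooth f -> 0 < h ->
  exists s t : R, [/\ 0 <= s <= h, 0 <= t <= h &
  f (h *: u + (h *: v + x)) - f (h *: u + x) - (f (h *: v + x) - f x)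
  = h * (h * 'D_v ('D_u f) (t *: v + (s *: u + x)))].
Proof.
move=> fs h0.
pose g z := f (h *: v + z) - f z.
have dfs z : differentiable (fun z => f (h *: v + z)) z.
  apply: (@differentiable_comp _ _ _ _ (fun z => h *: v + z)).
    exact: differentiableD.
  exact: smooth_differentiable.
have dg z : differentiable g z.
  by apply: differentiableB => //; exact: smooth_differentiable.
have [s sh E] := MVT_line u x dg h0.
have Dg z : 'D_u g z = 'D_u f (h *: v + z) - 'D_u f z.
  rewrite deriveB; [congr (_ - _)|exact: diff_derivable|exact: smooth_derivable].
  have Et : (fun k : R => k^-1 *: (f (h *: v + (k *: u + z)) - f (h *: v + z)))
      = (fun k : R => k^-1 *: (f (k *: u + (h *: v + z)) - f (h *: v + z))).
    by apply/funext => k; rewrite addrCA.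
  by rewrite /derive /comp /shift /= Et.
rewrite Dg in E.
have [t th Et] := MVT_line v (s *: u + x)
  (fun z => smooth_differentiable z (smooth_derive u fs)) h0.
exists s, t; split=> //; rewrite -Et -E /g.
by rewrite [h *: v + (h *: u + x)]addrCA addrAC opprB addrA addrAC.
Qed.

(** The second difference is symmetric in u and v, so the two mixed derivatives take a common value
    at two points close to x; continuity at x concludes. *)
Lemma smooth_deriveC f u v x : smooth f -> 'D_u ('D_v f) x = 'D_v ('D_u f) x.
Proof.
move=> fs; apply/eqP; rewrite -subr_eq0 -normr_le0; apply/ler_addgt0Pl => e e0.
rewrite addr0.
have cont a b : exists2 r : R, 0 < r & forall z, `|x - z| < r ->
    `|'D_a ('D_b f) x - 'D_a ('D_b f) z| < e / 2.
  have /differentiable_continuous : differentiable ('D_a ('D_b f)) x.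
    exact/smooth_differentiable/smooth_derive/smooth_derive.
  move/cvgr_dist_lt => /(_ (e / 2)); rewrite divr_gt0// => /(_ isT).
  by move=> /nbhs_normP[r /= r0 Hr]; exists r.
have [r1 r10 H1] := cont u v; have [r2 r20 H2] := cont v u.
(* With h = r / M, displacements by at most h along u and v have norm at most h (|u| + |v|) < h M =
   r; the summand 1 makes this strict and M positive. *)
pose r := Num.min r1 r2; pose M := `|u| + `|v| + 1.
have M0 : 0 < M by rewrite ltr_wpDl// addr_ge0.
pose h := r / M; have h0 : 0 < h by rewrite divr_gt0// lt_min r10.
have near a b (s t : R) : 0 <= s <= h -> 0 <= t <= h -> `|a| + `|b| < M ->
    `|x - (t *: b + (s *: a + x))| < r.
  move=> /andP[s0 sh] /andP[t0 th] abM.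
  rewrite addrA distrC addrK (le_lt_trans (ler_normD _ _))//.
  rewrite !normrZ (ger0_norm s0) (ger0_norm t0).
  apply: (@le_lt_trans _ _ (h * (`|a| + `|b|))).
    by rewrite mulrDr addrC lerD// ler_wpM2r.
  by rewrite -[ltRHS](@divfK _ M) ?gt_eqF// ltr_pM2l.
have [s [t [s1 t1 E1]]] := second_difference u v x fs h0.
have [s' [t' [s2 t2 E2]]] := second_difference v u x fs h0.
have E : 'D_v ('D_u f) (t *: v + (s *: u + x))
    = 'D_u ('D_v f) (t' *: u + (s' *: v + x)).
  have hn0 : h != 0 by rewrite gt_eqF.
  apply/(mulfI hn0)/(mulfI hn0); rewrite -E1 -E2.
  by rewrite [h *: v + (h *: u + x)]addrCA !opprB ![f x - _]addrC addrACA.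
have uvM : `|u| + `|v| < M by rewrite ltrDl.
have := near _ _ _ _ s1 t1 uvM; rewrite lt_min => /andP[_ /H2 B].
have := near v u _ _ s2 t2; rewrite addrC => /(_ uvM).
rewrite lt_min => /andP[/H1 A _].
rewrite E distrC in B.
apply: le_trans (ler_distD ('D_u ('D_v f) (t' *: u + (s' *: v + x))) _ _) _.
rewrite (splitr e).
exact: (lerD (ltW A) (ltW B)).
Qed.

End Smooth.

(** * Smooth functions as a commutative algebra with commuting derivations *)

Section SmoothRing.
Local Open Scope ring_scope.
Variables (R : realType) (V : normedModType R).

Definition smooth_pred : {pred V -> R} := fun f => `[< smooth f >].

Lemma smooth_predP f : f \in smooth_pred <-> smooth f.
Proof. by split=> [/asboolP|fs]//; apply/asboolP. Qed.

Record smooth_fun := SmoothFun {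
  smooth_val :> V -> R;
  _ : smooth_val \in smooth_pred }.

HB.instance Definition _ := [isSub for smooth_val].
HB.instance Definition _ := [Choice of smooth_fun by <:].

Fact smooth_subring : subring_closed smooth_pred.
Proof.
split=> [|f g /smooth_predP fs /smooth_predP gs|f g /smooth_predP fs /smooth_predP gs].
- exact/smooth_predP/smooth_cst.
- rewrite (_ : f - g = f + cst (-1) * g); last first.
    by apply/funext => x; rewrite -[RHS]/(f x + (-1) * g x) mulN1r.
  by apply/smooth_predP/smoothD => //; apply/smoothM => //; apply: smooth_cst.
- exact/smooth_predP/smoothM.
Qed.

HB.instance Definition _ := GRing.isSubringClosed.Build _ smooth_pred smooth_subring.
HB.instance Definition _ := [SubChoice_isSubComNzRing of smooth_fun by <:].

Fact smooth_scaler : GRing.scaler_closed smooth_pred.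
Proof.
move=> a f /smooth_predP fs; apply/smooth_predP.
by rewrite (_ : a *: f = cst a * f)//; apply: smoothM => //; apply: smooth_cst.
Qed.
HB.instance Definition _ := GRing.isScaleClosed.Build R (V -> R) smooth_pred smooth_scaler.
HB.instance Definition _ := [SubZmodule_isSubLmodule of smooth_fun by <:].

Fact smooth_scaleAl (a : R) (f g : smooth_fun) : a *: (f * g) = (a *: f) * g.
Proof. by apply/val_inj/funext => x; exact: mulrA. Qed.
HB.instance Definition _ := GRing.Lmodule_isLalgebra.Build R smooth_fun smooth_scaleAl.
HB.instance Definition _ := GRing.Lalgebra_isComAlgebra.Build R smooth_fun.


Lemma smooth_funP (f : smooth_fun) : smooth f.
Proof. by apply/smooth_predP; case: f. Qed.

Definition to_smooth f (fs : smooth f) : smooth_fun :=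
  SmoothFun (proj2 (smooth_predP f) fs).

Definition sderive (v : V) (f : smooth_fun) : smooth_fun :=
  to_smooth (smooth_derive v (smooth_funP f)).

Lemma sderive_linear v : linear (sderive v).
Proof.
move=> a f g; apply/val_inj/funext => x.
rewrite -[LHS]/('D_v (a *: (f : V -> R) + (g : V -> R)) x).
rewrite deriveD; [|exact/derivableZ/smooth_derivable/smooth_funP
  |exact/smooth_derivable/smooth_funP].
by rewrite deriveZ//; exact/smooth_derivable/smooth_funP.
Qed.

HB.instance Definition _ v :=
  GRing.isLinear.Build R smooth_fun smooth_fun *:%R (sderive v) (sderive_linear v).

Lemma sderiveM v (f g : smooth_fun) :
  sderive v (f * g) = sderive v f * g + f * sderive v g.
Proof.
apply/val_inj/funext => x.
rewrite -[LHS]/('D_v ((f : V -> R) * (g : V -> R)) x).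
rewrite deriveM; [|exact/smooth_derivable/smooth_funP..].
by rewrite addrC [_ *: 'D_v f x]mulrC.
Qed.

Lemma sderiveC u v f : sderive u (sderive v f) = sderive v (sderive u f).
Proof. apply/val_inj/funext => x; exact/smooth_deriveC/smooth_funP. Qed.

Lemma derive_linear (f : {linear V -> R}) v x : continuous f -> 'D_v f x = f v.
Proof.
by move=> fc; rewrite deriveE ?diff_lin//; exact: linear_differentiable.
Qed.

Lemma smooth_linear (f : {linear V -> R}) : continuous f -> smooth f.
Proof.
move=> fc; apply: smooth_derive_cst => [x|v]; first exact: linear_differentiable.
by exists (f v); apply/funext => x; exact: derive_linear.
Qed.

End SmoothRing.

Section SmoothFst.
Local Open Scope ring_scope.
Variables (R : realType) (V W : normedModType R).

Lemma smooth_fst (f : V -> R) : smooth f -> smooth (fun z : V * W => f z.1).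
Proof.
move=> fs; apply: (@smooth_coind _ _
  (fun h => exists2 g : V -> R, smooth g & h = fun z => g z.1)); last by exists f.
move=> _ [g gs ->]; split=> [z|v].
  apply: (@differentiable_comp _ _ _ _ fst g).
    by apply: linear_differentiable => ?; exact: cvg_fst.
  exact: smooth_differentiable.
(* Difference quotients of z |-> g z.1 along v are those of g along v.1. *)
by exists ('D_(v.1) g) => //; exact: smooth_derive.
Qed.

End SmoothFst.

(** * Coordinate functions and their partial derivatives *)

Section CotangentCoordinates.
Local Open Scope ring_scope.
Variables (R : realType) (d : nat).
Local Notation T := (cotangent R d).
Local Notation I := (coord_index d).

Lemma coordinate_linear (a : I) : linear (coordinate a : T -> R).
Proof. by move=> c y z; case: a => i /=; rewrite !mxE. Qed.

HB.instance Definition _ (a : I) :=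
  GRing.isLinear.Build R T R *:%R (@coordinate R d a) (coordinate_linear a).

Lemma coordinate_continuous (a : I) : continuous (coordinate a : T -> R).
Proof.
case: a => i z.
  apply: (@continuous_comp _ _ _ fst (fun x : 'rV[R]_d => x 0 i)).
    exact: cvg_fst.
  exact: coord_continuous.
apply: (@continuous_comp _ _ _ snd (fun x : 'rV[R]_d => x 0 i)).
  exact: cvg_snd.
exact: coord_continuous.
Qed.

Lemma smooth_coordinate (a : I) : smooth (coordinate a : T -> R).
Proof. exact/smooth_linear/coordinate_continuous. Qed.

Lemma partial_coordinate (a b : I) (z : T) :
  partial a (coordinate b) z = (a == b)%:R.
Proof.
rewrite /partial derive_linear; last exact: coordinate_continuous.
by case: a b => i [] j; rewrite /= !mxE ?eqxx//= eq_sym.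
Qed.

End CotangentCoordinates.

(** * The algebra of smooth functions on the cotangent space *)

Section Transfer.
Local Open Scope ring_scope.
Variables (R : realType) (d : nat).
Local Notation T := (cotangent R d).
Local Notation I := (coord_index d).
Local Notation A := (smooth_fun T).
Implicit Types (f g : A) (F G : series A) (y : 'I_d -> series A).

Definition sfun_eval (z : T) (f : A) : R := f z.

Lemma sfun_eval_linear z : linear (sfun_eval z). Proof. by []. Qed.
HB.instance Definition _ z :=
  GRing.isLinear.Build R A R *:%R (sfun_eval z) (sfun_eval_linear z).

Lemma sfun_sum J (r : seq J) (P : pred J) (E : J -> A) z :
  (\sum_(j <- r | P j) E j) z = \sum_(j <- r | P j) E j z.
Proof. exact: (raddf_sum (sfun_eval z)). Qed.

Lemma sfunM f g z : (f * g) z = f z * g z. Proof. by []. Qed.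
Lemma sfunD f g z : (f + g) z = f z + g z. Proof. by []. Qed.
Lemma sfunN f z : (- f) z = - f z. Proof. by []. Qed.
Lemma sfunZ (a : R) f z : (a *: f) z = a * f z. Proof. by []. Qed.
Lemma sfun0 z : (0 : A) z = 0. Proof. by []. Qed.

Lemma sfun_prod J (r : seq J) (E : J -> A) z :
  (\prod_(j <- r) E j) z = \prod_(j <- r) E j z.
Proof. by elim/big_rec2: _ => // j _ u _ <-. Qed.

Definition dA (a : I) : {linear A -> A} := sderive (basis_vector R a).

Definition coordA (a : I) : A := to_smooth (@smooth_coordinate R d a).

Lemma dAM a f g : dA a (f * g) = dA a f * g + f * dA a g.
Proof. exact: sderiveM. Qed.

Lemma dAC a b f : dA a (dA b f) = dA b (dA a f).
Proof. exact: sderiveC. Qed.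

Lemma dA_coordA a b : dA a (coordA b) = (a == b)%:R.
Proof.
apply/val_inj/funext => z; rewrite -[LHS]/(partial a (coordinate b) z).
by rewrite partial_coordinate; case: (a == b).
Qed.

(** The bridge to series of arbitrary functions: it is injective and intertwines products,
    composition, brackets and pullbacks. *)
Definition forget F : fseries R d := fun n z => F n z.

Lemma forget_mul F G : forget (F * G) = fs_mul (forget F) (forget G).
Proof.
by apply/funext => n; apply/funext => z; rewrite /forget coefSM sfun_sum.
Qed.

Lemma forget_sconst f : forget (sconst f) = fs_const f.
Proof.
apply/funext => n; apply/funext => z; rewrite /forget /sconst /fs_const.
by case: eqP.
Qed.

Lemma forget1 : forget 1 = fs_const (fun=> 1).
Proof. by apply/funext => -[|n]. Qed.

Lemma forget_prod J (r : seq J) (E : J -> series A) :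
  \big[@fs_mul R d/fs_const (fun=> 1)]_(j <- r) forget (E j)
  = forget (\prod_(j <- r) E j).
Proof. by rewrite (big_morph _ forget_mul forget1). Qed.

Lemma forget_inj F G : forget F = forget G -> F = G.
Proof.
move=> FG; apply/funext => n; apply/val_inj/funext => z.
exact: (congr1 (fun h : fseries R d => h n z) FG).
Qed.

Local Notation cmp := (scomp (fun i => dA (inl i))).
Local Notation W y := (fun i => forget (fmapA coordA y (inl i))).

Lemma iter_partial_xE (s : seq 'I_d) f :
  iter_partial_x s f = foldr (fun i => dA (inl i)) f s.
Proof. by elim: s => //= i s ->. Qed.

Let dxM i f g : dA (inl i) (f * g) = dA (inl i) f * g + f * dA (inl i) g.
Proof. exact: dAM. Qed.
Let dxC i j f : dA (inl i) (dA (inl j) f) = dA (inl j) (dA (inl i) f).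
Proof. exact: dAC. Qed.

Let base_point y z : small y -> (\row_i W y i 0%N z, z.2) = z.
Proof.
move=> y1; case: z => x p; congr pair; apply/rowP => i.
by rewrite mxE /forget /fmapA coefSD (y1 i 0%N)// addr0.
Qed.

Lemma taylor_sconst y n f :
  taylor (fun i => smap (dA (inl i))) idfun y n (sconst f) =
  (n`!%:R^-1 : R) *: \sum_(s : n.-tuple 'I_d)
      (\prod_(i <- s) y i) * sconst (foldr (fun i => dA (inl i)) f s).
Proof.
rewrite taylor_tuple; last first.
  by move=> i j F; apply/funext => m; exact: dxC.
congr (_ *: _); apply: eq_bigr => s _; congr (_ * _).
by elim: (s : seq _) => //= i r ->; rewrite smap_sconst.
Qed.

Lemma scomp_sconst0 y f : cmp y (sconst f) 0%N = f.
Proof. by rewrite /scomp /ssum big_ord1. Qed.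

Lemma fs_comp_funE y f : small y ->
  fs_comp_fun (W y) f = forget (cmp y (sconst f)).
Proof.
move=> y1; apply/funext => N; apply/funext => z.
rewrite /fs_comp_fun /forget /scomp /ssum sfun_sum; apply: eq_bigr => n _.
rewrite taylor_sconst coefSZ coefS_sum sfunZ sfun_sum; congr (_ * _).
apply: eq_bigr => s _; rewrite base_point// iter_partial_xE.
rewrite [_ * sconst _]mulrC coef_sconstM sfunM mulrC; congr (_ * _).
(* Each y_i is epsilon times its tail; the n factors epsilon account for the index shift N - n in
   [fs_comp_fun]. *)
pose tl i : series A := fun n => y i n.+1.
have yE i : y i = epsilon A * tl i.
  by apply/funext => -[|m]; rewrite coef_epsilonM// y1.
have -> : \prod_(i <- s) y i = epsilon A ^+ n * \prod_(i <- s) tl i.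
  rewrite -{2}(size_tuple s); elim: (s : seq _) => [|i r IH].
    by rewrite !big_nil mul1r.
  by rewrite !big_cons IH exprS yE mulrACA.
have tlE i : fs_tail (W y i) = forget (tl i).
  by apply/funext => m; apply/funext => u; rewrite /fs_tail /forget /fmapA coefSD add0r.
under eq_bigr => i _ do rewrite tlE.
by rewrite forget_prod coef_epsilonXM -ltnS ltn_ord.
Qed.

Lemma fs_compE y F : small y -> fs_comp (W y) (forget F) = forget (cmp y F).
Proof.
move=> y1; apply/funext => N; apply/funext => z.
rewrite [in RHS]/forget (scomp_coef _ _ dxM y1) sfun_sum; apply: eq_bigr => k _.
by rewrite fs_comp_funE.
Qed.


(** * Transport of the algebraic results to a Poisson structure *)

Section Poisson.
Variable pi : 'I_d -> 'I_d -> 'rV[R]_d -> R.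
Hypothesis hpi : poisson_structure pi.

Lemma poisson_smooth_fst i j : smooth (fun z : T => pi i j z.1).
Proof. by apply: smooth_fst; case: hpi. Qed.

Definition piA (i j : 'I_d) : A := to_smooth (poisson_smooth_fst i j).

Let dp_piA k i j : dA (inr k) (piA i j) = 0.
Proof.
(* The basis vector of p_k has base component 0. *)
apply/val_inj/funext => z; rewrite -[LHS]/('D_0 (pi i j) z.1).
exact: derive0.
Qed.

Let piA_anti i j : piA i j = - piA j i.
Proof. by apply/val_inj/funext => z; case: hpi => _ anti _; exact: anti. Qed.

Let piA_jacobi i j k :
  \sum_l (piA i l * dA (inl l) (piA j k) + piA j l * dA (inl l) (piA k i)
          + piA k l * dA (inl l) (piA i j)) = 0.
Proof.
apply/val_inj/funext => z; rewrite [LHS]sfun_sum.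
by case: hpi => _ _ /(_ i j k z.1).
Qed.

Local Notation valg := (valg coordA piA).
Local Notation lieA := (lieA dA coordA piA).
Local Notation lie_iter := (lie_iter dA coordA piA).
Local Notation phiA := (phiA dA coordA piA).
Local Notation omA := (omA dA coordA piA).
Local Notation solA := (solA dA coordA piA).

Lemma valgE a : Vbar pi a = valg a.
Proof.
apply/funext => z; case: a => // i.
by rewrite [RHS]sfunN sfun_sum.
Qed.

Lemma lie_funE f : lie_fun (Vbar pi) f = lieA f.
Proof.
apply/funext => z; rewrite [RHS]sfun_sum; apply: eq_bigr => a _.
by rewrite valgE.
Qed.

Lemma LVxE n i : LVx pi n i = lie_iter n i.
Proof.
by elim: n => //= n IH; rewrite -lie_funE -IH.
Qed.

Lemma phiE i : phi pi i = forget (phiA i).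
Proof. by apply/funext => n; apply/funext => z; rewrite /phi LVxE /forget /phiA sfunZ. Qed.

Lemma omega0E a b : omega0 a b = omA 0 a b :> (T -> R).
Proof.
apply/funext => z; rewrite [RHS]sfun_sum.
under eq_bigr => i _ do
  rewrite -[lie_iter 0 i]/(coordA (inl i)) sfunD sfunN !sfunM !dA_coordA.
have E (u v : I) : ((u == v)%:R : A) z = (u == v)%:R by case: (u == v).
under eq_bigr => i _ do rewrite !E.
have S (k l : 'I_d) : \sum_i ((k == i)%:R * (l == i)%:R : R) = (k == l)%:R.
  rewrite (bigD1 k)//= eqxx mul1r big1 ?addr0 1?eq_sym// => i ik.
  by rewrite eq_sym (negbTE ik) mul0r.
case: a b => k [] l /=.
- by rewrite big1// => i _; rewrite !mul0r subrr.
- by rewrite -S -sumrN; apply: eq_bigr => i _; rewrite mul0r sub0r mulrC.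
- by rewrite -S; apply: eq_bigr => i _; rewrite mul0r subr0.
- by rewrite big1// => i _; rewrite !mulr0 subrr.
Qed.

Lemma lie_formE (om : I -> I -> A) :
  lie_form (Vbar pi) (fun a b => om a b : T -> R)
  = (fun a b => lie_formA dA coordA piA om a b : T -> R).
Proof.
apply/funext => a; apply/funext => b; apply/funext => z.
rewrite [RHS]sfunD [X in _ = _ + X]sfun_sum /lie_form lie_funE; congr (_ + _).
by apply: eq_bigr => c _; rewrite !valgE.
Qed.

Lemma iter_lie_formE n (om : I -> I -> A) :
  iter n (lie_form (Vbar pi)) (fun a b => om a b : T -> R)
  = (fun a b => iter n (lie_formA dA coordA piA) om a b : T -> R).
Proof.
by elim: n => [|n IH]; [|rewrite iterS IH lie_formE].
Qed.

Lemma weinstein_formE a b :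
  weinstein_form pi a b = forget (weinsteinA dA coordA piA a b).
Proof.
apply/funext => n; apply/funext => z; rewrite /weinstein_form.
have -> : @omega0 R d = (fun a b => omA 0 a b : T -> R).
  by apply/funext => u; apply/funext => v; exact: omega0E.
by rewrite iter_lie_formE (iter_lie_formA dAM dAC dA_coordA) /forget
  /weinsteinA sfunZ.
Qed.

Lemma karasev_solution_of y : solA y -> karasev_solution pi (W y).
Proof.
move=> [y1 yE]; split; first split.
- by move=> i n; exact: (smooth_funP (fmapA coordA y (inl i) n)).
- by move=> i; apply/funext => z; rewrite /forget /fmapA coefSD y1// addr0.
- by move=> i; rewrite phiE fs_compE// yE forget_sconst.
Qed.

(** The smoothness built into a solution lifts its coefficients to the algebra, so claims about an
    arbitrary solution reduce to [solA]. *)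
Lemma karasev_solution_lift alpha : karasev_solution pi alpha ->
  exists2 y, solA y & alpha = W y.
Proof.
move=> [[alphas alpha0] alphaE].
pose y i : series A := fun n => if n is m.+1 then to_smooth (alphas i n) else 0.
have y1 : small y by move=> i [].
have E : alpha = W y.
  apply/funext => i; apply/funext => n; apply/funext => z.
  rewrite /forget /fmapA coefSD; case: n => [|n]; first by rewrite addr0 alpha0.
  by rewrite add0r.
exists y => //; split=> // i; apply: forget_inj.
by rewrite -fs_compE// -E -phiE alphaE forget_sconst.
Qed.

Lemma fiber_mapE y a : fiber_map (W y) a = forget (fmapA coordA y a).
Proof. by case: a => i //=; rewrite forget_sconst. Qed.

Lemma fs_bracketE F G : fs_bracket (forget F) (forget G) = forget
  (\sum_l (smap (dA (inl l)) F * smap (dA (inr l)) G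
          - smap (dA (inr l)) F * smap (dA (inl l)) G)).
Proof.
apply/funext => n; apply/funext => z; rewrite /forget coefS_sum sfun_sum.
under [RHS]eq_bigr => l _ do
  rewrite coefSD coefSN !coefSM sfunD sfunN !sfun_sum -sumrB.
by rewrite exchange_big.
Qed.

Lemma fs_pullbackE y (om : I -> I -> series A) a b : small y ->
  fs_pullback (W y) (fun c e => forget (om c e)) a b = forget
  (\sum_c \sum_e cmp y (om c e)
    * (smap (dA a) (fmapA coordA y c) * smap (dA b) (fmapA coordA y e))).
Proof.
move=> y1; apply/funext => n; apply/funext => z.
rewrite /fs_pullback [in RHS]/forget coefS_sum sfun_sum; apply: eq_bigr => c _.
rewrite coefS_sum sfun_sum; apply: eq_bigr => e _.
rewrite fs_compE// !fiber_mapE -[RHS]/(forget _ n z) !forget_mul.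
by [].
Qed.

Lemma karasev_sumE y i N z : solA y -> (1 <= N)%N ->
  \sum_(1 <= n < N) \sum_(1 <= m < (N - n).+1)
        \sum_(r : {ffun 'I_m -> 'I_N.+1} |
               [forall k, (1 <= r k)%N] && (\sum_(k < m) r k == N - n)%N)
          \sum_(s : m.-tuple 'I_d)
            (n.+1`!%:R * m`!%:R)^-1
            * (\prod_(k < m) W y (tnth s k) (r k) z)
            * iter_partial_x s (LVx pi n i) z =
  (\sum_(1 <= n < N) cmp y (sconst (phiA i n)) (N - n)%N) z.
Proof.
move=> [y1 yE] N1; rewrite sfun_sum [LHS]big_nat_cond [RHS]big_nat_cond.
apply: eq_bigr => n /andP[/andP[n1 nN] _].
rewrite /scomp /ssum sfun_sum -(big_mkord xpredT
  (fun m => (taylor (fun i => smap (dA (inl i))) idfun y m (sconst (phiA i n)))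
    (N - n)%N z)).
(* The term m = 0, absent from the recursion, is a constant series taken in degree N - n > 0. *)
rewrite big_ltn//; rewrite [X in _ = X + _](_ : _ = 0) ?add0r; last first.
  by rewrite /= /sconst subn_eq0 leqNgt nN.
rewrite [LHS]big_nat_cond [RHS]big_nat_cond.
apply: eq_bigr => m /andP[/andP[m1 mN] _].
rewrite taylor_sconst coefSZ coefS_sum sfunZ sfun_sum exchange_big mulr_sumr.
apply: eq_bigr => s _ /=.
rewrite [_ * sconst _]mulrC coef_sconstM sfunM big_tuple (coef_prod (N := N)).
- rewrite sfun_sum mulr_sumr mulr_sumr; apply: eq_bigr => r /andP[/forallP r1 _].
  rewrite sfun_prod LVxE iter_partial_xE.
  have -> : foldr (fun i => dA (inl i)) (phiA i n) s
     = (n.+1`!%:R^-1 : R) *: foldr (fun i => dA (inl i)) (lie_iter n i) s.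
    by elim: (s : seq _) => //= j t ->; rewrite linearZ.
  rewrite sfunZ invfM -!mulrA mulrCA; congr (_ * _).
  congr (_ * _); rewrite mulrC; congr (_ * _).
  apply: eq_bigr => k _; rewrite /forget /fmapA coefSD /sconst.
  by rewrite -[_ == _]negbK -lt0n r1 add0r.
- exact: leq_subr.
- by move=> k; exact: y1.
Qed.

(** The coefficient N >= 1 of phi(alpha(x,p), p) = x. As phi_0 = x, the term n = 0 is alpha_N; the
    term n = N involves only the constant coefficient of the substitution. *)
Lemma karasev_recursion_of y : solA y -> karasev_recursion pi (W y).
Proof.
move=> sy; have [y1 yE] := sy; move=> N i z N1; rewrite karasev_sumE//.
have := congr1 (fun F : series A => F N z) (yE i).
rewrite /sconst; case: eqP N1 => [->//|_ N1]; rewrite sfun0 => <-.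
rewrite [in RHS](scomp_coef _ _ dxM y1) [RHS]sfun_sum.
rewrite -(big_mkord xpredT (fun k => cmp y (sconst (phiA i k)) (N - k)%N z)).
rewrite [RHS]big_nat_recr// [in RHS]big_ltn// subn0 subnn -sfun_sum LVxE.
congr (_ + _ + _).
  rewrite /phiA (_ : 1`! = 1)%N// invr1 scale1r.
  by rewrite (scomp_coord dAM dA_coordA).
by rewrite scomp_sconst0 /phiA sfunZ.
Qed.

(** In the sum n >= 1 forces every r_k <= N - n < N, so the coefficient N is determined by the lower
    ones. *)
Lemma karasev_recursion_unique (al be : 'I_d -> fseries R d) :
  (forall i, al i 0%N = be i 0%N) ->
  karasev_recursion pi al -> karasev_recursion pi be -> al = be.
Proof.
move=> ab0 ra rb; suff E N i z : al i N z = be i N z.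
  by apply/funext => i; apply/funext => N; apply/funext => z.
elim/ltn_ind: N i z => -[|N] IH i z; first by rewrite ab0.
have /addIr := etrans (ra N.+1 i z isT) (esym (rb N.+1 i z isT)).
set Sa := (X in _ + X = _); set Sb := (X in _ = _ + X).
suff -> : Sa = Sb by move/addIr.
rewrite /Sa /Sb [LHS]big_nat_cond [RHS]big_nat_cond.
apply: eq_bigr => n /andP[/andP[n1 nN] _].
apply: eq_bigr => m _; apply: eq_bigr => r /andP[_ /eqP rs].
apply: eq_bigr => s _; congr (_ * _ * _); apply: eq_bigr => k _; apply: IH.
rewrite (@leq_ltn_trans (N.+1 - n))//; last by rewrite ltn_subrL n1.
by rewrite -rs (bigD1 k)//= leq_addr.
Qed.

Lemma karasev_solution_exists : exists! alpha, karasev_solution pi alpha.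
Proof.
have [y sy] := solA_exists dAM dA_coordA piA.
exists (W y); split; first exact: karasev_solution_of.
move=> beta /karasev_solution_lift[z sz ->].
by rewrite (solA_unique dAM dA_coordA sy sz).
Qed.

Lemma karasev_solution_realization y : solA y ->
  formal_symplectic_realization pi (W y).
Proof.
move=> sy; have [y1 _] := sy; split; first by have [] := karasev_solution_of sy.
move=> i j; rewrite fs_bracketE.
rewrite (solA_bracket dAM dAC dA_coordA dp_piA piA_anti piA_jacobi i j sy).
rewrite -[fun z => pi i j z.1]/(piA i j : T -> R) -forget_sconst fs_compE//.
apply/funext => n; apply/funext => z; rewrite /forget coef_epsilonM.
by case: n.
Qed.

Lemma karasev_solution_inverse y : solA y -> mutually_inverse (phi pi) (W y).
Proof.
move=> sy; have [y1 yE] := sy.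
have vs := phi_tail_small dA coordA piA.
pose v := phi_tail dA coordA piA.
have phiW : phi pi = W v by apply/funext => i; rewrite phiE phiA_fmap.
have inv a := sol_inverse dAM dAC dA_coordA a sy.
by rewrite phiW; split=> a; rewrite fiber_mapE fs_compE// ?(inv a).1 ?(inv a).2
  forget_sconst.
Qed.

Lemma karasev_solution_pullback y a b : solA y ->
  fs_pullback (W y) (weinstein_form pi) a b = fs_const (@omega0 R d a b).
Proof.
move=> sy; have [y1 yE] := sy.
have -> : weinstein_form pi = fun a b => forget (weinsteinA dA coordA piA a b).
  by apply/funext => c; apply/funext => e; rewrite weinstein_formE.
rewrite fs_pullbackE// (pullback_weinstein dAM dAC dA_coordA a b sy).
by rewrite forget_sconst -omega0E.
Qed.

Lemma fs_comp_coordinate y i : small y ->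
  fs_comp (W y) (fs_const (coordinate (inl i))) = W y i.
Proof.
move=> y1; rewrite -[coordinate _]/(coordA (inl i) : T -> R) -forget_sconst.
by rewrite fs_compE// (fmapA_scomp dAM dA_coordA).
Qed.

End Poisson.
End Transfer.

Theorem theorem15 (R : realType) (d : nat)
    (pi : 'I_d -> 'I_d -> 'rV[R]_d -> R) (hpi : poisson_structure pi) :
  (exists! alpha : 'I_d -> fseries R d, karasev_solution pi alpha) /\
  forall alpha : 'I_d -> fseries R d, karasev_solution pi alpha ->
    (* (1) *)
    formal_symplectic_realization pi alpha /\
    (* (2): the recursion holds, and it determines the coefficients *)
    (karasev_recursion pi alpha /\
     forall beta : 'I_d -> fseries R d,
       (forall i, beta i 0%N = coordinate (inl i)) ->
       karasev_recursion pi beta -> beta = alpha) /\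
    (* (3) *)
    (mutually_inverse (phi pi) alpha /\
     (forall a b : coord_index d,
        fs_pullback alpha (weinstein_form pi) a b
        = fs_const (@omega0 R d a b)) /\
     (forall i : 'I_d,
        fs_comp alpha (fs_const (@coordinate R d (inl i))) = alpha i)).
Proof.
split; first exact: karasev_solution_exists.
move=> alpha /[dup] ha /(karasev_solution_lift hpi)[y sy aE].
have ra : karasev_recursion pi alpha by rewrite aE; exact: karasev_recursion_of sy.
split; first by rewrite aE; exact: karasev_solution_realization sy.
split.
  split=> // beta b0 rb; apply: karasev_recursion_unique rb ra => i.
  by rewrite b0 (proj2 (proj1 ha)).
have [y1 _] := sy; rewrite aE; split; first exact: karasev_solution_inverse sy.
split=> [a b|i]; first exact: karasev_solution_pullback sy.
exact: fs_comp_coordinate.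
Qed.
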